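(* Let $q=p^h$ with $p$ prime, and let $\mathcal{G}$, of order $(s,t)$, be one of the following generalised quadrangles: (1) a classical generalised quadrangle, i.e. $W(3,q)$, $Q(4,q)$, $Q(5,q)$, $H(3,q^2)$, or $H(4,q^2)$; (2) $T_2^*(O)$, where $O$ is a hyperoval in $\mathrm{PG}(2,q)$, $q$ even; (3) a translation generalised quadrangle of order $(q^n,q^m)$. Let $C$ be the dual code of the $p$-ary code of $\mathcal{G}$. Then $C$ has repair degree $r=s$ and repair availability $a=(p-1)(t+1)$.
   Context: A generalised quadrangle of order $(s,t)$ is an incidence structure of points and lines such that: through every two distinct points there is at most one line and every two distinct lines meet in at most one point; every line contains $s+1$ points; every point lies on $t+1$ lines; for every point $P$ and every line $L$ not through $P$ there is exactly one line through $P$ which intersects $L$. The $p$-ary code of $\mathcal{G}$: let $N$ be the incidence matrix of $\mathcal{G}$ with rows indexed by lines and columns indexed by points; the $p$-ary code of $\mathcal{G}$ is the $\mathbb{F}_p$-span of the rows of $N$. Its dual code is the set of all vectors over $\mathbb{F}_p$ (indexed by points) whose standard dot product with every codeword is $0$. Repair degree and availability: let $C$ be a linear code over $\mathbb{F}_p$ of length $M$, and let $\mathrm{wt}$ denote Hamming weight. For a position $i$ let $\Omega(i)=\{v\in C^\perp : v_i\neq 0\}$ and $r(i)=\min\{\mathrm{wt}(v)-1 : v\in\Omega(i)\}$. The repair degree of $C$ is $r=\max_{1\le i\le M} r(i)$. Let $\Omega_r(i)=\{v\in\Omega(i) : \mathrm{wt}(v)\le r+1\}$ and $a(i)=|\Omega_r(i)|$.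 The repair availability of $C$ is $a=\min_{1\le i\le M} a(i)$. Classical generalised quadrangles: $W(3,q)$ has as points all points of $\mathrm{PG}(3,q)$ and as lines the totally isotropic lines of a non-degenerate symplectic polarity (order $(q,q)$); $Q(4,q)$ and $Q(5,q)$ consist of the points and lines contained in a non-singular quadric of $\mathrm{PG}(4,q)$, respectively a non-singular elliptic quadric of $\mathrm{PG}(5,q)$ (orders $(q,q)$ and $(q,q^2)$); $H(3,q^2)$ and $H(4,q^2)$ consist of the points and lines contained in a non-singular Hermitian variety of $\mathrm{PG}(3,q^2)$, respectively $\mathrm{PG}(4,q^2)$ (orders $(q^2,q)$ and $(q^2,q^3)$). $T_2^*(O)$: let $O$ be a hyperoval, i.e. a set of $q+2$ points of $\mathrm{PG}(2,q)$, $q$ even, no three collinear. Embed $\mathrm{PG}(2,q)$ as a plane $H$ of $\mathrm{PG}(3,q)$. The points of $T_2^*(O)$ are the points of $\mathrm{PG}(3,q)\setminus H$, the lines are the lines of $\mathrm{PG}(3,q)$ not in $H$ meeting $H$ in a point of $O$, with natural incidence (order $(q-1,q+1)$). Translation generalised quadrangles: an egg $\mathcal{E}$ in $\mathrm{PG}(2n+m-1,q)$ ($n,m\geq 1$) is a set of $q^m+1$ subspaces, each of dimension $n-1$, such that any three different elements span a $(3n-1)$-dimensional subspace, and each $E\in\mathcal{E}$ is contained in an $(n+m-1)$-dimensional subspace $T_E$ (the tangent space at $E$) which is disjoint from every element of $\mathcal{E}\setminus\{E\}$. Embed $\mathrm{PG}(2n+m-1,q)$ as a hyperplane $H_\infty$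 in $\Pi\cong\mathrm{PG}(2n+m,q)$. The points of the incidence structure $T(\mathcal{E})$ are: (i) the points of $\Pi\setminus H_\infty$; (ii) the $(n+m)$-dimensional subspaces of $\Pi$ intersecting $H_\infty$ in a tangent space of $\mathcal{E}$; (iii) a symbol $(\infty)$. The lines are: (a) the $n$-dimensional subspaces of $\Pi$ intersecting $H_\infty$ in an element of $\mathcal{E}$; (b) the elements of $\mathcal{E}$. Incidence: $(\infty)$ is incident with all lines of type (b) and no line of type (a); a point of type (ii) is incident with the lines of type (a) contained in it and with the unique line of type (b) contained in it; a point of type (i) is incident with the lines of type (a) containing it and with no line of type (b). $T(\mathcal{E})$ is a generalised quadrangle of order $(q^n,q^m)$. A translation generalised quadrangle is one isomorphic to $T(\mathcal{E})$ for some egg $\mathcal{E}$.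
   Formalization: In case (2) the formal theorem assumes q > 2: for q = 2, T_2^*(O) is the complete bipartite graph K_{4,4}, whose binary code is the even-weight code of length 8, so the availability is 7 rather than (p-1)(t+1) = 4. *)

(* Defs.v *)
From HB Require Import structures.
From mathcomp Require Import all_boot all_order all_algebra all_field.

Set Implicit Arguments.
Unset Strict Implicit.
Unset Printing Implicit Defensive.

Import GRing.Theory.
Local Open Scope ring_scope.

(* The subspaces of a finite vector space form a finite type. PG(k-1, q) is
   rendered as the subspaces of 'rV[F]_k with #|F| = q, so every projective
   dimension is shifted by one. *)
Section FiniteVspace.
Variables (F : finFieldType) (vT : vectType F).
HB.instance Definition _ : isCountable {vspace vT} :=
  CanIsCountable (@VectorInternalTheory.vs2mxK F vT).
HB.instance Definition _ : isFinite {vspace vT} :=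
  CanIsFinite (@VectorInternalTheory.vs2mxK F vT).
End FiniteVspace.

Record incidence_structure := IncidenceStructure {
  point : finType;
  line : finType;
  inc : point -> line -> bool
}.

Definition isomorphic (G G' : incidence_structure) : Prop :=
  exists (f : point G -> point G') (g : line G -> line G'),
    [/\ bijective f, bijective g & forall x l, inc (f x) (g l) = inc x l].

Definition generalised_quadrangle (s t : nat) (G : incidence_structure) : Prop :=
  [/\ forall x y : point G, x != y -> (#|[set l | inc x l & inc y l]| <= 1)%N,
      forall l l' : line G, l != l' -> (#|[set x | inc x l & inc x l']| <= 1)%N,
      forall l : line G, #|[set x | inc x l]| = s.+1,
      forall x : point G, #|[set l | inc x l]| = t.+1
    & forall (x : point G) (l : line G), ~~ inc x l ->
        #|[set l' | inc x l' & [exists y, inc y l' && inc y l]]| = 1%N].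

Section Codes.
Variables (p : nat) (I : finType).
Local Notation word := {ffun I -> ('F_p)^o}.

Implicit Types (v w : word) (C : {vspace word}) (i : I).

Definition dotp v w : ('F_p)^o := \sum_i v i * w i.

Definition wt v : nat := #|[set i | v i != 0]|.

Definition dual C : {vspace word} :=
  (\bigcap_(c in C) lker (linfun (dotp c)))%VS.

Fact dotp_is_linear v : linear (dotp v).
Proof.
move=> a w w'; rewrite /dotp scaler_sumr -big_split; apply: eq_bigr => i _ /=.
by rewrite !ffunE mulrDr mulrCA.
Qed.

Lemma mem_dual C v :
  reflect (forall c, c \in C -> dotp c v = 0) (v \in dual C).
Proof.
pose lin c := GRing.isLinear.Build _ _ _ _ (dotp c) (dotp_is_linear c).
pose dot c : {linear word -> ('F_p)^o} := HB.pack (dotp c) (lin c).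
have kerE c : (v \in lker (linfun (dotp c))) = (dotp c v == 0).
  by rewrite memv_ker (lfunE (dot c)).
apply: (iffP idP) => [vC c cC | vC].
  by apply/eqP; rewrite -kerE; apply: subvP vC; apply: bigcapv_inf cC _.
rewrite /dual memvE; apply/subv_bigcapP => c cC.
by rewrite -memvE kerE vC.
Qed.

Definition repair_words C i : {set word} :=
  [set v | (v \in dual C) && (v i != 0)].

(* Every weight is at most #|I|, so the default #|I| only matters when there is
   no repair word at i. *)
Definition repair_degree_at C i : nat :=
  \big[minn/#|I|]_(v in repair_words C i) (wt v - 1)%N.

Definition repair_degree C : nat := \max_i repair_degree_at C i.

Definition min_repair_words C i : {set word} :=
  [set v in repair_words C i | (wt v <= repair_degree C + 1)%N].

(* The default #|word| is an upper bound for the terms; it only matters for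
   codes of length 0. *)
Definition repair_availability C : nat :=
  \big[minn/#|{: word}|]_i #|min_repair_words C i|.

End Codes.

Definition incidence_row p (G : incidence_structure) (l : line G) :
    {ffun point G -> ('F_p)^o} :=
  [ffun x => (inc x l)%:R].

Definition code p (G : incidence_structure) : {vspace {ffun point G -> ('F_p)^o}} :=
  <<[seq incidence_row p l | l : line G]>>%VS.

Section Classical.
Variables (F : finFieldType) (k : nat).
Local Notation V := 'rV[F]_k.

Definition subspace_geometry (onP onL : pred {vspace V}) :=
  @IncidenceStructure
    {x : {vspace V} | (\dim x == 1)%N && onP x}
    {l : {vspace V} | (\dim l == 2)%N && onL l}
    (fun x l => (val x <= val l)%VS).

Definition symplectic_geometry (f : {skew_symmetric V}) :=
  subspace_geometry predT (fun l => (l <= orthov f l)%VS).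

Definition zeros_geometry (Q : V -> F) :=
  let contained := fun U : {vspace V} => [forall u in U, Q u == 0] in
  subspace_geometry contained contained.

(* Every quadratic form on 'rV[F]_k is of this shape, in any characteristic;
   A need not be symmetric. *)
Definition quadratic_form (A : 'M[F]_k) (v : V) : F := (v *m A *m v^T) 0 0.

Definition polar_form (Q : V -> F) (u v : V) : F := Q (u + v) - Q u - Q v.

Definition nonsingular (Q : V -> F) : Prop :=
  forall v, Q v = 0 -> (forall u, polar_form Q u v = 0) -> v = 0.

Definition witt_index (Q : V -> F) : nat :=
  \max_(U : {vspace V} | [forall u in U, Q u == 0]) \dim U.

(* For k = 6 the Witt index of a nonsingular form is 3 (hyperbolic: the quadric
   contains planes) or 2 (elliptic: lines but no planes). *)
Definition elliptic (Q : V -> F) : Prop := nonsingular Q /\ witt_index Q = 2.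

End Classical.

(* In the Hermitian cases theta is the involutory automorphism of the field of
   order q ^ 2. *)
Inductive classical_GQ (q : nat) (G : incidence_structure) : Prop :=
| Is_W3 (F : finFieldType) (f : {skew_symmetric 'rV[F]_4}) of
    #|F| = q & is_psymplectic f & isomorphic G (symplectic_geometry f)
| Is_Q4 (F : finFieldType) (A : 'M[F]_5) of
    #|F| = q & nonsingular (quadratic_form A)
    & isomorphic G (zeros_geometry (quadratic_form A))
| Is_Q5 (F : finFieldType) (A : 'M[F]_6) of
    #|F| = q & elliptic (quadratic_form A)
    & isomorphic G (zeros_geometry (quadratic_form A))
| Is_H3 (K : finFieldType) (theta : {rmorphism K -> K})
    (f : {hermitian_sym 'rV[K]_4 for theta}) of
    #|K| = (q ^ 2)%N & (forall a, theta a = a ^+ q) & is_unitary f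
    & isomorphic G (zeros_geometry (fun v => f v v))
| Is_H4 (K : finFieldType) (theta : {rmorphism K -> K})
    (f : {hermitian_sym 'rV[K]_5 for theta}) of
    #|K| = (q ^ 2)%N & (forall a, theta a = a ^+ q) & is_unitary f
    & isomorphic G (zeros_geometry (fun v => f v v)).

Section T2star.
Variables (F : finFieldType).
Local Notation V := 'rV[F]_4.
Variables (H : {vspace V}) (O : {set {vspace V}}).

Definition hyperoval : Prop :=
  [/\ #|O| = (#|F| + 2)%N,
      forall x, x \in O -> \dim x = 1%N /\ (x <= H)%VS
    & forall l : {vspace V}, \dim l = 2 ->
        (#|[set x in O | (x <= l)%VS]| <= 2)%N].

Definition T2star :=
  @IncidenceStructure
    {x : {vspace V} | (\dim x == 1)%N && ~~ (x <= H)%VS}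
    {l : {vspace V} | [&& (\dim l == 2)%N, ~~ (l <= H)%VS
                        & (l :&: H)%VS \in O]}
    (fun x l => (val x <= val l)%VS).

End T2star.

Definition T2star_GQ (q : nat) (G : incidence_structure) : Prop :=
  exists (F : finFieldType) (H : {vspace 'rV[F]_4})
         (O : {set {vspace 'rV[F]_4}}),
    [/\ #|F| = q, \dim H = 3, hyperoval H O & isomorphic G (T2star H O)].

Section Eggs.
Variables (F : finFieldType) (n m : nat).
Local Notation V := 'rV[F]_(2 * n + m + 1).
Variables (H : {vspace V}) (E : {set {vspace V}}).

Definition tangent_space (X T : {vspace V}) : bool :=
  [&& (T <= H)%VS, (\dim T == n + m)%N, (X <= T)%VS
    & [forall Y in E, (Y != X) ==> (T :&: Y == 0)%VS]].

Definition egg : Prop :=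
  [/\ #|E| = (#|F| ^ m + 1)%N,
      forall X, X \in E -> \dim X = n /\ (X <= H)%VS,
      forall X Y Z, X \in E -> Y \in E -> Z \in E ->
        X != Y -> X != Z -> Y != Z -> \dim (X + Y + Z)%VS = (3 * n)%N
    & forall X, X \in E -> exists T, tangent_space X T].

Definition affine_point := {x : {vspace V} | (\dim x == 1)%N && ~~ (x <= H)%VS}.

Definition tangent_point :=
  {U : {vspace V} | (\dim U == n + m + 1)%N
                    && [exists X in E, tangent_space X (U :&: H)%VS]}.

Definition affine_line :=
  {l : {vspace V} | (\dim l == n + 1)%N && ((l :&: H)%VS \in E)}.

Definition egg_line := {X : {vspace V} | X \in E}.

(* inr tt is the symbol (infty). *)
Definition T_egg_inc (x : affine_point + tangent_point + unit)
    (l : affine_line + egg_line) : bool :=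
  match x, l with
  | inl (inl P), inl L => (val P <= val L)%VS
  | inl (inl _), inr _ => false
  | inl (inr U), inl L => (val L <= val U)%VS
  | inl (inr U), inr X => (val X <= val U)%VS
  | inr _, inl _ => false
  | inr _, inr _ => true
  end.

Definition T_egg := IncidenceStructure T_egg_inc.

End Eggs.

Definition translation_GQ (q n m : nat) (G : incidence_structure) : Prop :=
  exists (F : finFieldType) (H : {vspace 'rV[F]_(2 * n + m + 1)})
         (E : {set {vspace 'rV[F]_(2 * n + m + 1)}}),
    [/\ #|F| = q, \dim H = (2 * n + m)%N, egg H E & isomorphic G (T_egg H E)].

(* Main.v *)
Require Import Defs.
From mathcomp Require Import all_boot all_order all_algebra all_field.
From mathcomp Require Import zify.

(* The repair words are the codewords of the code of G, so it is enough to show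
   that a nonzero codeword c of weight at most s + 1 is a multiple of a line.
   The tool is always a dual word adapted to the support S of c, obtained from a
   subspace T through prescribed points that avoids the other points of S; such
   a T of codimension n exists as soon as at most q ^ n points are to be avoided.

   Classical case: all hyperplanes carry the same sum of c. Were S not a line,
   some hyperplane would meet S in exactly one point and another one would miss
   S. In W(3,q) a hyperbolic line l is excluded by the dual word l - l^perp.

   T_2^*(O), where p = 2: products of r < q - 1 affine functions sum to zero on
   affine lines, and for r = q - 1 the sum only depends on the direction.
   Products that vanish on all of S but one point show that S is an affine line;
   products that vanish on all of O but one point show that its direction is in O.

   T(E): the affine points of a subspace M of codimension n not at infinity, minus
   the points of type (ii) whose egg element misses M, form a dual word. If S has
   an affine point, these words force S to consist of q ^ n affine points and one
   point of type (ii), and then to be a line. Otherwise the values of c on the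
   points of type (ii) and at (infty) satisfy a covering condition: every affine
   point lies on points of type (ii) of constant total value. This forces a full
   line of type (b), except when S has one point on each line of type (b) and
   n = m, which the dual word of M with M :&: H = X0 + X1 (X0, X1 in E) excludes. *)

Set Implicit Arguments.
Unset Strict Implicit.
Unset Printing Implicit Defensive.

Import GRing.Theory.
Local Open Scope ring_scope.

(** * Repair parameters of a dual code *)

Section CodeTheory.
Variables (p : nat) (I : finType).
Local Notation word := {ffun I -> ('F_p)^o}.
Implicit Types (C : {vspace word}) (c v w : word).

Lemma dotpC v w : dotp v w = dotp w v.
Proof. by apply: eq_bigr => i _; rewrite mulrC. Qed.

Lemma ffun_delta_sum w : w = \sum_j w j *: ([ffun k => (k == j)%:R] : word).
Proof.
apply/ffunP => k; rewrite sum_ffunE (bigD1 k) //= big1 ?addr0 => [|j jk].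
  by rewrite !ffunE eqxx [_ *: _]mulr1.
by rewrite !ffunE eq_sym (negPf jk) [_ *: _]mulr0.
Qed.

(** The map [f] subtracts the projection to [C], so it vanishes exactly on [C]. Each coordinate of
    [f] is the dot product with a fixed word [r], which lies in the dual code; so [f] kills every
    word of the double dual. *)
Lemma dual_dual C : dual (dual C) = C.
Proof.
apply/eqP; rewrite eqEsubv; apply/andP; split; apply/subvP => v vC; last first.
  by apply/mem_dual => c /mem_dual cC; rewrite dotpC cC.
pose f := (\1 - projv C)%VF.
have fE w : f w = w - projv C w by rewrite add_lfunE opp_lfunE id_lfunE.
suff /eqP : f v = 0 by rewrite fE subr_eq0 => /eqP ->; apply: memv_proj.
apply/ffunP => i; rewrite [RHS]ffunE.
pose r : word := [ffun j => f [ffun k => (k == j)%:R] i].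
have rE w : f w i = dotp r w.
  rewrite {1}(ffun_delta_sum w) linear_sum sum_ffunE; apply: eq_bigr => j _.
  by rewrite linearZ /= !ffunE mulrC.
rewrite rE; move/mem_dual: vC; apply; apply/mem_dual => c cC.
by rewrite dotpC -rE fE projv_id // subrr ffunE.
Qed.

End CodeTheory.

Section IncidenceCode.
Variables (p : nat) (G : incidence_structure).
Local Notation word := {ffun point G -> ('F_p)^o}.
Implicit Types (c : word) (l : line G) (x : point G).

Lemma incidence_row_code l : incidence_row p l \in code p G.
Proof. by apply: memv_span; apply/imageP; exists l. Qed.

Lemma code_sum c : c \in code p G ->
  exists a : line G -> 'F_p, forall x, c x = \sum_(l | inc x l) a l.
Proof.
have suffE a : c = \sum_l (a l : 'F_p) *: incidence_row p l ->
    forall x, c x = \sum_(l | inc x l) a l.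
  move=> -> x; rewrite sum_ffunE [RHS]big_mkcond; apply: eq_bigr => l _.
  by rewrite !ffunE; case: inc; rewrite [LHS](mulr1, mulr0).
rewrite /code /image_mem; move=> cC.
pose X := map_tuple (@incidence_row p G) (enum_tuple (line G)).
have /coord_span cE : c \in <<X>>%VS by [].
exists (fun l => coord X (enum_rank l) c).
apply: suffE; rewrite {1}cE (reindex_onto (@enum_rank _) (@enum_val _ _)) /=; last first.
  by move=> i _; rewrite enum_valK.
apply: eq_big => [l|l _]; first by rewrite enum_rankK eqxx.
rewrite (nth_map l); first by rewrite nth_enum_rank.
  by rewrite -cardE ltn_ord.
Qed.

(** Beyond the axioms of a quadrangle, this is what the two repair parameters require of the
    geometry. *)
Definition min_words_are_lines (s : nat) : Prop :=
  forall c, c \in code p G -> c != 0 -> (wt c <= s.+1)%N ->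
  exists l (a : 'F_p), c = a *: incidence_row p l.

Lemma wtZ (a : 'F_p) c : a != 0 -> wt (a *: c) = wt c.
Proof.
by move=> a0; apply: eq_card => x; rewrite !inE ffunE mulf_eq0 (negPf a0).
Qed.

Lemma wt_incidence_row l : wt (incidence_row p l) = #|[set x | inc x l]|.
Proof. by apply: eq_card => x; rewrite !inE ffunE; case: inc; rewrite ?oner_eq0 ?eqxx. Qed.

Lemma mem_repair_words_dual_code x c :
  (c \in repair_words (dual (code p G)) x) = (c \in code p G) && (c x != 0).
Proof. by rewrite inE dual_dual. Qed.

Lemma bigmin_eq (T : finType) (P : pred T) (F : T -> nat) d m i0 :
  P i0 -> F i0 = m -> (m <= d)%N -> (forall i, P i -> m <= F i)%N ->
  \big[minn/d]_(i | P i) F i = m.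
Proof.
move=> Pi0 Fi0 md mF; apply/eqP; rewrite eqn_leq; apply/andP; split.
  have := mem_index_enum i0; elim: (index_enum T) => //= i r IHr.
  rewrite inE big_cons => /orP [/eqP <-|/IHr le_rm]; first by rewrite Pi0 Fi0 geq_minl.
  by case: ifP => // _; apply: leq_trans (geq_minr _ _) le_rm.
by elim/big_ind: _ => // a b ma mb; rewrite leq_min ma mb.
Qed.

Variables (s t : nat).
Hypothesis p_pr : prime p.
Hypothesis G_GQ : generalised_quadrangle s t G.
Hypothesis s_gt0 : (0 < s)%N.
Hypothesis G_min : min_words_are_lines s.

Let card_line l : #|[set x | inc x l]| = s.+1.
Proof. by case: G_GQ. Qed.

Let exists_line x : exists l, inc x l.
Proof.
have [_ _ _ /(_ x) xt _] := G_GQ.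
have /card_gt0P [l] : (0 < #|[set l | inc x l]|)%N by rewrite xt.
by rewrite inE; exists l.
Qed.

Lemma wt_code_ge c : c \in code p G -> c != 0 -> (s < wt c)%N.
Proof.
move=> cC c0; rewrite ltnNge; apply/negP => wc.
have [l [a cE]] := G_min cC c0 (leqW wc).
have a0 : a != 0 by apply: contraNneq c0 => a0; rewrite cE a0 scale0r.
by move: wc; rewrite cE wtZ // wt_incidence_row card_line ltnn.
Qed.

Lemma repair_degree_dual_code : (0 < #|point G|)%N ->
  repair_degree (dual (code p G)) = s.
Proof.
case/card_gt0P => x0 _.
have degE x : repair_degree_at (dual (code p G)) x = s.
  have [l xl] := exists_line x.
  apply: (bigmin_eq (i0 := incidence_row p l)).
  - by rewrite mem_repair_words_dual_code incidence_row_code ffunE xl oner_eq0.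
  - by rewrite wt_incidence_row card_line subn1.
  (* The default value, the number of points, is at least [s] because a line already has [s + 1]
     points. *)
  - by rewrite -ltnS -(card_line l); apply: leq_trans (max_card _) (leqnSn _).
  move=> c; rewrite mem_repair_words_dual_code => /andP [cC cx].
  by rewrite leq_subRL ?add1n ?wt_code_ge // ?(leq_ltn_trans _ (wt_code_ge _ _)) //;
     apply: contraNneq cx => ->; rewrite ffunE.
rewrite /repair_degree; under eq_bigr => x _ do rewrite degE.
apply/eqP; rewrite eqn_leq; apply/andP; split; first by apply/bigmax_leqP.
exact: (leq_bigmax_cond (F := fun=> s) x0).
Qed.

(** The repair words at [x] of weight at most [s + 1] correspond to pairs of a nonzero scalar and a
    line through [x]: the value at [x] gives the scalar, the support gives the line. *)
Lemma repair_availability_dual_code : (0 < #|point G|)%N ->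
  repair_availability (dual (code p G)) = ((p - 1) * (t + 1))%N.
Proof.
move=> G_gt0; have dE := repair_degree_dual_code G_gt0.
(* Distinct lines share at most one point, while a line has [s + 1 > 1] points. *)
have inj l l' : (forall x, inc x l = inc x l') -> l = l'.
  move=> ll'; apply/eqP; apply: contraT => ne_ll'.
  have [_ /(_ _ _ ne_ll') + _ _ _] := G_GQ.
  have -> : [set x | inc x l & inc x l'] = [set x | inc x l].
    by apply/setP => x; rewrite !inE -ll' andbb.
  by rewrite card_line ltnS leqNgt s_gt0.
have cardE x : #|min_repair_words (dual (code p G)) x| = ((p - 1) * (t + 1))%N.
  pose f (al : 'F_p * line G) : word := al.1 *: incidence_row p al.2.
  have fE a l y : f (a, l) y = if inc y l then a else 0.
    by rewrite !ffunE; case: inc; rewrite [LHS](mulr1, mulr0).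
  have -> : min_repair_words (dual (code p G)) x =
      f @: setX [set~ 0] [set l | inc x l].
    apply/setP => c; rewrite inE mem_repair_words_dual_code dE addn1.
    apply/idP/imsetP => [/andP [/andP [cC cx] wc]|[[a l]]].
      have c0 : c != 0 by apply: contraNneq cx => ->; rewrite ffunE.
      have [l [a cE]] := G_min cC c0 wc.
      exists (a, l) => //; move: cx; rewrite cE [X in X != 0]fE !inE /=.
      by case: inc; rewrite ?eqxx ?andbT.
    rewrite !inE /= => /andP [a0 xl] ->.
    rewrite memvZ ?incidence_row_code // [X in X != 0]fE xl a0.
    by rewrite wtZ // wt_incidence_row card_line /=.
  rewrite card_in_imset => [|[a l] [a' l'] /setXP [a0 xl] /setXP [a'0 xl'] ff].
    rewrite cardsX cardsC1 card_Fp // subn1 addn1.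
    by have [_ _ _ -> _] := G_GQ.
  move: a0 a'0 xl xl'; rewrite !inE /= => a0 a'0 xl xl'.
  have := congr1 (fun c : word => c x) ff; rewrite !fE xl xl' => aa'.
  rewrite -aa' in ff *; congr (_, _); apply: inj => y.
  have := congr1 (fun c : word => c y) ff; rewrite !fE.
  by do 2!case: inc => //; move/eqP; rewrite ?(negPf a0) // eq_sym (negPf a0).
case/card_gt0P: G_gt0 => x0 _.
apply: (bigmin_eq (i0 := x0)) => // [|x _]; last by rewrite cardE.
by rewrite -(cardE x0) max_card.
Qed.

End IncidenceCode.

Lemma min_words_isomorphic p s (G G' : incidence_structure) :
  isomorphic G G' -> min_words_are_lines p G' s -> min_words_are_lines p G s.
Proof.
move=> [f [g [f_bij [g1 gK g1K] fgE]]] G'_min c cC c0 wc.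
have [f1 fK f1K] := f_bij.
have [a aE] := code_sum cC.
pose c' : {ffun point G' -> ('F_p)^o} := [ffun x => c (f1 x)].
have c'C : c' \in code p G'.
  have -> : c' = \sum_l a (g1 l) *: incidence_row p l.
    apply/ffunP => x; rewrite sum_ffunE ffunE aE (reindex g1) /=; last first.
      by exists g => l _.
    rewrite big_mkcond; apply: eq_bigr => l _.
    rewrite !ffunE -fgE f1K g1K; case: inc; rewrite [RHS](mulr1, mulr0) //.
  by apply: rpred_sum => l _; rewrite rpredZ ?incidence_row_code.
have c'E x : c x = c' (f x) by rewrite ffunE fK.
have [||l [b c'b]] := G'_min c' c'C.
- by apply: contraNneq c0 => c'0; apply/eqP/ffunP => x; rewrite c'E c'0 !ffunE.
- suff -> : wt c' = wt c by [].
  rewrite /wt -(card_imset _ (bij_inj f_bij)); apply: eq_card => x.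
  rewrite inE; apply/idP/imsetP => [c'x|[y]]; last by rewrite inE c'E => ? ->.
  by exists (f1 x); rewrite ?f1K // inE c'E f1K.
exists (g1 l), b; apply/ffunP => x; rewrite c'E c'b !ffunE.
by rewrite -[in RHS]fgE g1K.
Qed.

(** * Subspaces of a finite vector space *)

Lemma card_cover_bound (I T : finType) (A : {pred I}) (P : {pred T})
    (Y : I -> {pred T}) (b : nat) :
    (forall v, v \in P -> exists2 i, i \in A & v \in Y i) ->
    (forall i, i \in A -> #|[predI P & Y i]| <= b)%N ->
  (#|P| <= #|A| * b)%N.
Proof.
move=> cover cardY; rewrite -sum_nat_const.
apply: (@leq_trans (\sum_(i in A) #|[predI P & Y i]|)); last exact: leq_sum.
rewrite -sum1_card; under [X in (_ <= X)%N]eq_bigr => i _ do rewrite -sum1_card.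
rewrite (exchange_big_dep [in P]) /=; last by move=> i v _; rewrite inE => /andP [].
apply: leq_sum => v vP; have [i iA vY] := cover v vP.
by rewrite (bigD1 i) //= inE iA vP.
Qed.

Lemma card_sig_set (T : finType) (R P : pred T) : (forall x, P x -> R x) ->
  #|[set y : {x | R x} | P (val y)]| = #|[set x | P x]|.
Proof.
move=> PR; rewrite -(card_imset _ val_inj) /=; apply: eq_card => x.
rewrite inE; apply/imsetP/idP => [[y]|Px]; first by rewrite inE => Py ->.
by exists (Sub x (PR x Px)); rewrite ?inE ?SubK.
Qed.

Section Subspaces.
Variables (F : finFieldType) (k : nat).
Local Notation V := 'rV[F]_k.
Local Notation q := #|F|.
Implicit Types (U W D T x : {vspace V}) (v : V).

Lemma card_gt1 : (1 < q)%N. Proof. exact: finNzRing_gt1. Qed.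

Lemma dim_space : \dim {:V} = k.
Proof. by rewrite dimvf /dim /= mul1n. Qed.

Lemma card_vspaceD U W :
  #|[pred v | (v \in U) && (v \notin W)]| = (q ^ \dim U - q ^ \dim (U :&: W))%N.
Proof.
rewrite -!card_vspace.
have -> : #|U| = (#|(U :&: W)%VS| + #|[pred v | (v \in U) && (v \notin W)]|)%N.
  rewrite -(cardID [in W] [in U]); congr (_ + _)%N; apply: eq_card => v.
    by rewrite !inE memv_cap andbC.
  by rewrite !inE andbC.
by rewrite addKn.
Qed.

Lemma dim1_line x v : \dim x = 1%N -> v \in x -> v != 0 -> <[v]>%VS = x.
Proof.
move=> x1 vx v0; apply/eqP; rewrite eqEdim -memvE vx x1.
by rewrite dim_vline v0.
Qed.

Lemma dim1_eq x x' : \dim x = 1%N -> \dim x' = 1%N -> (x <= x')%VS -> x = x'.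
Proof. by move=> x1 x'1 xx'; apply/eqP; rewrite eqEdim xx' x1 x'1 /=. Qed.

Lemma dim1_neq0 x : \dim x = 1%N -> x != 0%VS.
Proof. by move=> x1; rewrite -dimv_eq0 x1. Qed.

Lemma dim1_capE x W : \dim x = 1%N -> ~~ (x <= W)%VS -> (x :&: W = 0)%VS.
Proof.
move=> x1 xW; apply/eqP; rewrite -dimv_eq0 -leqn0 -ltnS -[X in (_ < X)%N]x1.
rewrite ltn_neqAle dimvS ?capvSl // andbT; apply: contra xW => dx.
by apply/capv_idPl/eqP; rewrite eqEdim capvSl (eqP dx) /=.
Qed.

Lemma vpick_line x : \dim x = 1%N -> <[vpick x]>%VS = x.
Proof. by move=> x1; apply: dim1_line; rewrite ?memv_pick // vpick0 dim1_neq0. Qed.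

(** The vectors of [U] outside [W] are grouped by the point they span; each such point has q - 1
    nonzero vectors, none of them in [W]. *)
Lemma card_pointsD U W :
  (q.-1 * #|[set x | [&& \dim x == 1%N, (x <= U)%VS & ~~ (x <= W)%VS]]|)%N =
  (q ^ \dim U - q ^ \dim (U :&: W))%N.
Proof.
rewrite -card_vspaceD -[RHS]sum1_card mulnC -sum_nat_const.
pose line v := <[v]>%VS; rewrite [RHS](partition_big line
  [pred x | [&& \dim x == 1%N, (x <= U)%VS & ~~ (x <= W)%VS]]) /=; last first.
  move=> v /andP [vU vW]; rewrite -!memvE vU vW dim_vline.
  by have -> : v != 0 by apply: contraNneq vW => ->; rewrite mem0v.
apply: eq_big => [x|x]; rewrite inE // => /and3P [/eqP x1 xU xW].
have -> : q.-1 = #|[pred v | (v \in x) && (v \notin (0%VS : {vspace V}))]|.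
  by rewrite card_vspaceD x1 capv0 dimv0 expn1 subn1.
rewrite -sum1_card; apply: eq_bigl => v; rewrite !inE memv0.
apply/idP/idP => [/andP [vx v0]|/andP [/andP [vU vW] /eqP <-]].
  rewrite /line (dim1_line x1 vx v0) eqxx andbT (subvP xU) //=.
  by rewrite memvE (dim1_line x1 vx v0).
by rewrite memv_line; apply: contraNneq vW => ->; rewrite mem0v.
Qed.

Lemma card_points U :
  (q.-1 * #|[set x | (\dim x == 1%N) && (x <= U)%VS]|)%N = (q ^ \dim U).-1.
Proof.
transitivity (q ^ \dim U - q ^ \dim (U :&: 0))%N; last by rewrite capv0 dimv0 subn1.
rewrite -card_pointsD; congr (_ * _)%N; apply: eq_card => x; rewrite !inE.
rewrite subv0; case: eqP => //= x1.
by rewrite -dimv_eq0 x1 andbT.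
Qed.

Lemma card_line_points U : \dim U = 2 ->
  #|[set x | (\dim x == 1%N) && (x <= U)%VS]| = q.+1.
Proof.
move=> U2; apply/eqP; have q1 := card_gt1.
rewrite -(eqn_pmul2l (m := q.-1)) ?card_points; last by rewrite -ltnS prednK // ltnW.
by rewrite U2 -!subn1 -[X in (_ - X)%N](exp1n 2) subn_sqr addn1.
Qed.

(** The second hypothesis makes [H] at least a hyperplane, so it cuts [U] in codimension one; then q
    ^ (d + 1) - q ^ d divided by q - 1 is q ^ d. *)
Lemma card_affine_points U H : ~~ (U <= H)%VS -> (k <= (\dim H).+1)%N ->
  #|[set x | [&& \dim x == 1%N, (x <= U)%VS & ~~ (x <= H)%VS]]| =
    (q ^ \dim (U :&: H))%N /\ \dim U = (\dim (U :&: H)).+1.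
Proof.
move=> UH Hk.
have dU : \dim U = (\dim (U :&: H)).+1.
  apply/eqP; rewrite eqn_leq; apply/andP; split; last first.
    rewrite ltn_neqAle dimvS ?capvSl // andbT; apply: contra UH => /eqP dUH.
    by apply/capv_idPl/eqP; rewrite eqEdim capvSl dUH /=.
  rewrite -(leq_add2l (\dim H)) addnC -dimv_sum_cap -addSnnS leq_add2r.
  by rewrite (leq_trans _ Hk) // -[X in (_ <= X)%N]dim_space dimvS ?subvf.
split=> //; have q1 := card_gt1; apply/eqP.
rewrite -(eqn_pmul2l (m := q.-1)) ?card_pointsD; last by rewrite -ltnS prednK // ltnW.
by rewrite dU expnS -[X in (_ - X)%N]mul1n -mulnBl subn1.
Qed.

(* A maximal T missing A has T + <v> meet A for every v outside T, so the
   spaces T + a cover everything. *)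
Lemma avoid_points n D (A : {set {vspace V}}) :
    (0 < n)%N -> (#|A| <= q ^ n)%N ->
    (forall a, a \in A -> \dim a = 1%N /\ ~~ (a <= D)%VS) ->
  exists T, [/\ (D <= T)%VS, forall a, a \in A -> ~~ (a <= T)%VS
              & (k <= \dim T + n)%N].
Proof.
move=> n_gt0 cA AD.
pose ok T := (D <= T)%VS && [forall a in A, ~~ (a <= T)%VS].
have okD : ok D by rewrite /ok subvv; apply/forall_inP => a /AD [].
case: (arg_maxnP (fun T : {vspace V} => \dim T) okD) => T /andP [DT /forall_inP AT] maxT.
exists T; split => //; rewrite leqNgt; apply/negP => dT.
have cover v : v \in [pred v | (v \in {:V}%VS) && (v \notin T)] ->
    exists2 a, a \in A & v \in [pred v | v \in (T + a)%VS].
  rewrite !inE => /andP [_ vT].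
  have nok : ~~ ok (T + <[v]>)%VS.
    apply/negP => /maxT /=; rewrite leqNgt => /negP; apply.
    rewrite ltn_neqAle dimvS ?addvSl // andbT; apply: contra vT => /eqP dTv.
    have /eqP -> : (T == T + <[v]>)%VS by rewrite eqEdim addvSl dTv /=.
    by rewrite memvE addvSr.
  move: nok; rewrite /ok (subv_trans DT (addvSl _ _)) /=.
  rewrite negb_forall_in => /exists_inP [a aA]; rewrite negbK => aTv.
  have [a1 _] := AD a aA; exists a => //.
  have a_neq0 : vpick a != 0 by rewrite vpick0 dim1_neq0.
  have /memv_addP [t tT [w /vlineP [b ->] aE]] := subvP aTv _ (memv_pick a).
  have b0 : b != 0.
    apply: contraTneq tT => b0; apply/negP => tT; have := AT a aA.
    by rewrite -(vpick_line a1) -memvE aE b0 scale0r addr0 tT.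
  rewrite inE; have -> : v = - b^-1 *: t + b^-1 *: vpick a.
    by rewrite aE scalerDr scalerA mulVf // scale1r scaleNr addKr.
  by rewrite memv_add ?memvZ ?memv_pick.
have cardTa a : a \in A -> (#|[predI [pred v | (v \in {:V}%VS) && (v \notin T)]
     & [pred v | v \in (T + a)%VS]]| <= q ^ (\dim T).+1 - q ^ \dim T)%N.
  move=> aA; have [a1 _] := AD a aA.
  have TTa : ((T + a) :&: T = T)%VS by apply/capv_idPr/addvSl.
  have dTa : \dim (T + a) = (\dim T).+1.
    by rewrite dimv_disjoint_sum ?a1 ?addn1 // capvC dim1_capE ?AT.
  rewrite -dTa -[X in (_ - q ^ \dim X)%N]TTa -card_vspaceD; apply: subset_leq_card.
  by apply/subsetP => v; rewrite !inE => /andP [/andP [_ ->] ->].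
have := card_cover_bound cover cardTa; rewrite card_vspaceD dim_space capfv leqNgt.
have q1 := card_gt1; have q0 := ltnW q1.
suff -> : (#|A| * (q ^ (\dim T).+1 - q ^ \dim T) < q ^ k - q ^ \dim T)%N by [].
apply: leq_ltn_trans (_ : (_ <= q ^ n * (q ^ (\dim T).+1 - q ^ \dim T)))%N _.
  by rewrite leq_mul2r cA orbT.
(* With d the dimension of [T], the strict inequality comes from q ^ d < q ^ (n + d), where [n > 0]
   enters. *)
apply: leq_trans (leq_sub2r _ (leq_pexp2l q0 dT)).
rewrite mulnBr -!expnD addnS [(n + _)%N]addnC ltn_sub2l //.
  by rewrite ltn_exp2l // -addnS -[X in (X < _)%N]addn0 ltn_add2l.
by rewrite ltn_exp2l // -[X in (X < _)%N]addn0 ltn_add2l.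
Qed.

Lemma functional_avoiding D v : v \notin D ->
  exists w : 'cV[F]_k, (forall u, u \in D -> u *m w = 0) /\ (v *m w) 0 0 != 0.
Proof.
move=> vD; pose f := (\1 - projv D)%VF.
have fE u : f u = u - projv D u by rewrite add_lfunE opp_lfunE id_lfunE.
have [j fj] : exists j, f v 0 j != 0.
  apply/existsP; apply: contraR vD; rewrite negb_exists => /forallP fv0.
  have : f v = 0 by apply/rowP => j; rewrite mxE; apply/eqP; rewrite -[_ == _]negbK.
  by move/eqP; rewrite fE subr_eq0 => /eqP ->; apply: memv_proj.
have fM u : u *m col j (lin1_mx f) = col j (f u) by rewrite !colE mulmxA mul_rV_lin1.
exists (col j (lin1_mx f)); rewrite fM mxE fj; split=> // u uD.
by rewrite fM fE projv_id // subrr; apply/matrixP => a b; rewrite !mxE.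
Qed.

End Subspaces.

(** * Small codewords of geometries of points and lines of PG(k - 1, q) *)

(** For N points and d the dimension of [U], (q - 1) N = q ^ d - 1 reads - N = - 1 modulo p, unless
    d = 0, where N = 0. *)
Lemma card_points_natr (F : finFieldType) k p (U : {vspace 'rV[F]_k}) :
  (#|F|)%:R = 0 :> 'F_p ->
  #|[set x : {vspace 'rV[F]_k} | (\dim x == 1%N) && (x <= U)%VS]|%:R
    = (U != 0%VS)%:R :> 'F_p.
Proof.
move=> qp; have q1 : (#|F|).-1%:R = -1 :> 'F_p.
  by rewrite -subn1 natrB ?(ltnW (card_gt1 F)) // qp add0r.
have := congr1 (fun n => n%:R : 'F_p) (card_points U).
rewrite natrM q1 mulN1r => /eqP; rewrite eqr_oppLR => /eqP ->.
have [->|U0] := eqVneq U 0%VS; first by rewrite dimv0 oppr0.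
have dU : (0 < \dim U)%N by rewrite lt0n dimv_eq0.
rewrite -subn1 natrB ?expn_gt0 ?(ltnW (card_gt1 F)) //.
by rewrite natrX qp expr0n -[_ == _]negbK -lt0n dU sub0r opprK.
Qed.

Section SubspaceGeometry.
Variables (F : finFieldType) (k p : nat).
Local Notation V := 'rV[F]_k.
Local Notation q := #|F|.
Variables onP onL : pred {vspace V}.
Local Notation G := (subspace_geometry onP onL).
Local Notation word := {ffun point G -> ('F_p)^o}.
Implicit Types (U T l x : {vspace V}).

Hypothesis qp : q%:R = 0 :> 'F_p.
Hypothesis line_onP : forall l x, \dim l = 2 -> onL l -> \dim x = 1%N ->
  (x <= l)%VS -> onP x.

Lemma points_of_subset (P : {pred {vspace V}}) :
    (forall x, P x -> \dim x = 1%N /\ onP x) ->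
  #|[set y : point G | P (val y)]| = #|[set x | P x]|.
Proof.
move=> PP; rewrite -(@card_sig_set _ [pred x | (\dim x == 1%N) && onP x]) // => x /PP [x1 xP].
by rewrite /= x1 xP.
Qed.

Lemma card_line_subspace_geometry (l : line G) : #|[set y | inc y l]| = q.+1.
Proof.
have /andP [/eqP l2 lL] := valP l.
rewrite -(card_line_points l2) -[RHS](points_of_subset (P := [pred x | (\dim x == 1%N) && (x <= val l)%VS])).
  by apply: eq_card => y; rewrite !inE /=; have /andP [-> _] := valP y.
by move=> x /andP [/eqP x1 xl]; split=> //; apply: line_onP l2 lL x1 xl.
Qed.

(** A line meets [T] in 0, 1 or q + 1 points, hence in 0 or 1 modulo p; [line_onP] ensures that all
    of them are points of the geometry. *)
Lemma subspace_sum (c : word) (a : line G -> 'F_p) T :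
    (forall y, c y = \sum_(l | inc y l) a l) ->
  \sum_(y : point G | (val y <= T)%VS) c y = \sum_l a l * ((val l :&: T)%VS != 0%VS)%:R.
Proof.
move=> cE; under eq_bigr => y _ do rewrite cE.
rewrite (exchange_big_dep predT) //=; apply: eq_bigr => l _.
rewrite -(card_points_natr _ qp) sumr_const mulr_natr; congr (_ *+ _).
have /andP [/eqP l2 lL] := valP l.
rewrite -[RHS](points_of_subset (P := [pred x | (\dim x == 1%N) && (x <= val l :&: T)%VS])).
  apply: eq_card => y; rewrite !inE /= subv_cap [RHS]andbA.
  by have /andP [-> _] := valP y; rewrite andbC.
move=> x /andP [/eqP x1 xl]; split=> //; apply: line_onP l2 lL x1 _.
exact: subv_trans xl (capvSl _ _).
Qed.

(* Hyperplanes meet every line in 1 or q + 1 points, so they all carry the same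
   sum; a hyperplane meeting the support in one point, or missing it, exists as
   soon as the support is small and is not a line. *)
Lemma small_word_subspace_geometry (c : word) :
    c \in code p G -> c != 0 -> (wt c <= q.+1)%N ->
  exists l (b : 'F_p), [/\ \dim l = 2, forall x, \dim x = 1%N -> (x <= l)%VS -> onP x
    & forall y, c y = if (val y <= l)%VS then b else 0].
Proof.
move=> cC c0 wc; have [a aE] := code_sum cC.
pose S : {set {vspace V}} := [set val y | y in [set y | c y != 0]].
have cardS : (#|S| <= q.+1)%N by rewrite card_imset //; apply: val_inj.
have SP (y : point G) : (val y \in S) = (c y != 0).
  by rewrite mem_imset ?inE //; apply: val_inj.
have S1 x : x \in S -> \dim x = 1%N.
  by case/imsetP => y _ ->; have /andP [/eqP] := valP y.
have SonP x : x \in S -> onP x.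
  by case/imsetP => y _ ->; have /andP [] := valP y.
pose b := \sum_l a l.
have sumT T : (k <= \dim T + 1)%N -> \sum_(y : point G | (val y <= T)%VS) c y = b.
  move=> dT; rewrite (subspace_sum _ aE); apply: eq_bigr => l _.
  have /andP [/eqP l2 _] := valP l.
  suff -> : (val l :&: T)%VS != 0%VS by rewrite mulr1.
  rewrite -dimv_eq0 -lt0n -(ltn_add2l (\dim (val l + T))) addn0 dimv_sum_cap l2.
  rewrite add2n ltnS -[X in (_ <= X)%N]addn1; apply: leq_trans dT.
  by rewrite -[X in (_ <= X)%N](dim_space F) dimvS ?subvf.
(* If a hyperplane through [D] that avoids [A] can meet the support [S] only inside [D], then [D]
   itself carries the sum [b]. *)
have sumD D (A : {set {vspace V}}) : (#|A| <= q)%N ->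
    (forall x, x \in A -> \dim x = 1%N /\ ~~ (x <= D)%VS) ->
    (forall T x, (D <= T)%VS -> (forall x, x \in A -> ~~ (x <= T)%VS) ->
       x \in S -> (x <= T)%VS -> (x <= D)%VS) ->
    \sum_(y : point G | (val y <= D)%VS) c y = b.
  move=> cA AD SD; rewrite -(expn1 q) in cA.
  have [//|T [DT AT dT]] := avoid_points _ cA AD.
  rewrite -(sumT T) // [RHS](bigID (fun y : point G => (val y <= D)%VS)) /=.
  rewrite [X in _ + X]big1 ?addr0 => [|y /andP [yT yD]].
    apply: eq_bigl => y; apply/idP/andP => [yD|[] //].
    by rewrite (subv_trans yD DT).
  by apply/eqP; apply: contraNT yD; rewrite -SP => yS; apply: (SD T).
have line_eq := @dim1_eq F k.
(* A hyperplane through [y] that avoids the other points of [S] shows that every value on the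
   support is [b]. *)
have cS y : c y != 0 -> c y = b.
  move=> cy; have /andP [/eqP y1 _] := valP y.
  rewrite -(sumD (val y) (S :\ val y)).
  - rewrite (bigD1 y) ?subvv //= big1 ?addr0 // => z /andP [zy] /eqP [].
    by apply/val_inj/line_eq => //; have /andP [/eqP] := valP z.
  - by move: cardS; rewrite (cardsD1 (val y) S) SP cy.
  - move=> x; rewrite !inE => /andP [xy xS]; have x1 := S1 x xS.
    by split=> //; apply: contra xy => xy; apply/eqP/line_eq.
  move=> T x yT AT xS; apply: contraTT => xy; apply: AT.
  by rewrite !inE xS andbT; apply: contraNneq xy => ->.
have [y0 cy0] : exists y, c y != 0.
  apply/existsP; apply: contraNT c0; rewrite negb_exists => /forallP c0.
  by apply/eqP/ffunP => y; rewrite ffunE; apply/eqP; rewrite -[_ == _]negbK.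
have b0 : b != 0 by rewrite -(cS y0).
have y0S : val y0 \in S by rewrite SP.
have [x1 /setD1P [x1y0 x1S]] : exists x1, x1 \in S :\ val y0.
  apply/set0Pn; apply: contra_neq b0 => S1E.
  have SE : S = [set val y0].
    by apply/eqP; rewrite eqEsubset sub1set y0S andbT -setD_eq0 S1E.
  rewrite -(sumD 0%VS S).
  - rewrite big1 // => y; rewrite subv0 => /eqP y0E.
    by have /andP [] := valP y; rewrite y0E dimv0.
  - by rewrite SE cards1 ltnW ?card_gt1.
  - by move=> x xS; split; rewrite ?subv0 ?dim1_neq0 ?S1.
  by move=> T x _ AT xS; apply: contraTT => _; apply: AT.
pose l := (val y0 + x1)%VS.
have dy0 : \dim (val y0) = 1%N by apply: S1.
have dx1 : \dim x1 = 1%N by apply: S1.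
have sum2 x x' : \dim x = 1%N -> \dim x' = 1%N -> x != x' -> \dim (x + x') = 2.
  move=> d d' xx'; rewrite dimv_disjoint_sum ?d ?d' // dim1_capE //.
  by apply: contra xx' => xx'; apply/eqP/line_eq.
have l2 : \dim l = 2 by rewrite sum2 // eq_sym.
(* A hyperplane through a point [z] of [l] outside [S] that avoids [S] minus [y0] cannot contain
   [y0] either, as it would contain [l] and so [x1]. It misses [S], whence [b = 0]. *)
have lS z : \dim z = 1%N -> (z <= l)%VS -> z \in S.
  move=> z1 zl; apply: contraT => zS; case/eqP: b0; rewrite -(sumD z (S :\ val y0)).
  - rewrite big1 // => y yz; apply/eqP; rewrite -[_ == _]negbK -SP.
    by rewrite (line_eq (val y) z) //; have /andP [/eqP] := valP y.
  - by move: cardS; rewrite (cardsD1 (val y0) S) y0S.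
  - move=> x; rewrite !inE => /andP [_ xS]; have dx := S1 x xS.
    by split=> //; apply: contra zS => xz; rewrite -(line_eq x z).
  move=> T x zT AT xS xT; have [xy0|xy0] := eqVneq x (val y0); last first.
    by have := AT x; rewrite !inE xy0 xS xT => /(_ isT).
  have /negP [] : ~~ (x1 <= T)%VS by apply: AT; rewrite !inE x1y0.
  have zy0 : z != val y0 by apply: contraNneq zS => ->.
  have /eqP lE : (z + val y0 == l)%VS.
    by rewrite eqEdim subv_add zl addvSl l2 sum2.
  apply: subv_trans (addvSr (val y0) _) _; rewrite -/l -lE subv_add zT.
  by rewrite -xy0.
have SE : S = [set x | (\dim x == 1%N) && (x <= l)%VS].
  apply/esym/eqP; rewrite eqEcard card_line_points // cardS andbT.
  by apply/subsetP => x; rewrite inE => /andP [/eqP]; apply: lS.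
exists l, b; split=> // [x dx xl|y]; first by apply/SonP/lS.
have := SP y; rewrite SE inE; have /andP [-> _] := valP y => /= ->.
by have [->|/cS ->] := eqVneq (c y) 0.
Qed.

End SubspaceGeometry.

Lemma repair_of_isomorphic p s s' t (G G' : incidence_structure) :
    prime p -> generalised_quadrangle s t G -> isomorphic G G' ->
    (0 < #|point G'|)%N -> (0 < s')%N ->
    (forall l : line G', #|[set x | inc x l]| = s'.+1) ->
    min_words_are_lines p G' s' ->
  repair_degree (dual (code p G)) = s
  /\ repair_availability (dual (code p G)) = ((p - 1) * (t + 1))%N.
Proof.
move=> p_pr G_GQ iso G'0 s'0 cardl minw.
have [f [g [f_bij g_bij fgE]]] := iso.
have [f1 fK f1K] := f_bij.
have G0 : (0 < #|point G|)%N by rewrite (bij_eq_card f_bij).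
have [x0 _] := card_gt0P G0.
have ss' : s = s'.
  have [_ _ cl /(_ x0) xt _] := G_GQ.
  have /card_gt0P [l _] : (0 < #|[set l | inc x0 l]|)%N by rewrite xt.
  apply/eqP; rewrite -eqSS -(cl l) -(cardl (g l)) -(card_imset _ (bij_inj f_bij)).
  apply/eqP/eq_card => x; rewrite inE; apply/imsetP/idP => [[y]|xl].
    by rewrite inE -fgE => yl ->.
  by exists (f1 x); rewrite ?f1K // inE -fgE f1K.
rewrite ss' in G_GQ *; have minG := min_words_isomorphic iso minw.
by split; [rewrite (repair_degree_dual_code G_GQ) | rewrite (repair_availability_dual_code p_pr G_GQ)].
Qed.

(** * Power sums and zeros of forms *)

Section PowerSums.
Variable F : finFieldType.
Local Notation q := #|F|.

(** The shift by 1 permutes [F], so the sum of all elements equals itself plus q. *)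
Lemma natr_card_finField : q%:R = 0 :> F.
Proof.
apply: (addrI (\sum_(t : F) t)); rewrite addr0 -[in LHS]sumr_const -big_split /=.
by rewrite [RHS](reindex_inj (addIr 1)).
Qed.

Lemma natr_card_finField_pred : q.-1%:R = -1 :> F.
Proof. by rewrite -subn1 natrB ?(ltnW (card_gt1 F)) // natr_card_finField sub0r. Qed.

(** For e > 0, substituting [a * t] for [t] multiplies the sum by [a ^+ e]. A nonzero [a] with
    [a ^+ e != 1] exists because X ^ e - 1 has at most e < q - 1 roots. *)
Lemma sum_exp_lt e : (e < q.-1)%N -> \sum_(t : F) t ^+ e = 0.
Proof.
case: e => [_|e eq]; first by rewrite sumr_const natr_card_finField.
have [a /andP [a0 ae]] : exists a : F, (a != 0) && (a ^+ e.+1 != 1).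
  apply/existsP; apply: contraLR eq => /existsPn a1; rewrite -leqNgt.
  rewrite -(cardC1 (0 : F)) cardE.
  have e1 : ('X^(e.+1) - 1 : {poly F}) != 0 by rewrite -size_poly_eq0 size_XnsubC.
  have := max_poly_roots (rs := enum (predC1 (0 : F))) e1.
  rewrite size_XnsubC // ltnS; apply; last exact: enum_uniq.
  apply/allP => a; rewrite mem_enum inE => a0.
  by rewrite rootE !hornerE subr_eq0; have := a1 a; rewrite a0 /= negbK.
apply/eqP; have : (a ^+ e.+1 - 1) * \sum_(t : F) t ^+ e.+1 == 0.
  rewrite mulrBl mul1r subr_eq0 mulr_sumr [X in _ == X](reindex_inj (mulfI a0)) /=.
  by apply/eqP/eq_bigr => t _; rewrite exprMn.
by rewrite mulf_eq0 subr_eq0 (negPf ae).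
Qed.

Lemma sum_exp_pred : \sum_(t : F) t ^+ q.-1 = -1.
Proof.
have q1 := card_gt1 F.
have q'0 : (0 < q.-1)%N by rewrite -ltnS (ltn_predK q1).
rewrite (bigD1 0) //= expr0n -[_ == _]negbK -lt0n q'0 add0r.
rewrite -natr_card_finField_pred -[in RHS](cardC1 (0 : F)) -sumr_const.
apply: eq_big => [t|t t0]; first by rewrite inE.
by rewrite -(mulfK t0 (t ^+ q.-1)) -exprSr (ltn_predK q1) expf_card divff.
Qed.

End PowerSums.

Section Zeros.
Variables (F : finFieldType) (k : nat).
Local Notation q := #|F|.
Local Notation V := 'rV[F]_k.

(** The sum factors over the coordinates, and the bound on the total degree leaves some exponent
    below q - 1. *)
Lemma sum_monomial (e : 'I_k -> nat) : (\sum_i e i < k * q.-1)%N ->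
  \sum_(v : V) \prod_i v 0 i ^+ e i = 0.
Proof.
move=> lt_e; pose r (f : {ffun 'I_k -> F}) : V := \row_i f i.
rewrite (reindex r) /=; last first.
  exists (fun v : V => [ffun i => v 0 i]) => [f _|v _].
    by apply/ffunP => i; rewrite ffunE mxE.
  by apply/rowP => i; rewrite mxE ffunE.
under eq_bigr => f _ do under eq_bigr => i _ do rewrite mxE.
rewrite -(bigA_distr_bigA (fun i t => t ^+ e i)) /=.
have [i ei] : exists i, (e i < q.-1)%N.
  apply/existsP; apply: contraLR lt_e; rewrite negb_exists -leqNgt => /forallP le_e.
  rewrite -[X in (X * _)%N]card_ord -sum_nat_const leq_sum // => i _.
  by rewrite leqNgt.
by rewrite (bigD1 i) //= sum_exp_lt ?mul0r.
Qed.

(* The Chevalley-Warning argument: the sum of [1 - Q v ^+ r] over all v is both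
   the number of zeros of Q modulo the characteristic and, by the degree bound,
   zero. *)
Lemma nontrivial_zero (A : 'M[F]_k) (r d : nat) (Q : V -> F) :
    (forall v, Q v = \sum_i \sum_j A i j * (v 0 i * v 0 j ^+ d)) ->
    (forall v, Q v != 0 -> Q v ^+ r = 1) ->
    (0 < r)%N -> (r * d.+1 < k * q.-1)%N ->
  exists2 v, v != 0 & Q v = 0.
Proof.
move=> QE Q1 r0 lt_rd.
have sumQ : \sum_v Q v ^+ r = 0.
  pose term (v : V) (ij : 'I_k * 'I_k) := A ij.1 ij.2 * (v 0 ij.1 * v 0 ij.2 ^+ d).
  have QrE v : Q v ^+ r = \sum_(g : {ffun 'I_r -> 'I_k * 'I_k}) \prod_s term v (g s).
    rewrite -(bigA_distr_bigA (fun _ => term v)) prodr_const card_ord QE.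
    by rewrite pair_bigA.
  under eq_bigr => v _ do rewrite QrE.
  rewrite exchange_big big1 //= => g _.
  pose e i := (\sum_(s < r) (((g s).1 == i) + d * ((g s).2 == i)))%N.
  transitivity (\sum_v (\prod_s A (g s).1 (g s).2) * \prod_i (v : V) 0 i ^+ e i).
    apply: eq_bigr => v _; rewrite big_split /=; congr (_ * _).
    under [RHS]eq_bigr => i _ do rewrite -prodrXr.
    rewrite exchange_big; apply: eq_bigr => s _ /=.
    under eq_bigr => i _ do rewrite exprD.
    rewrite big_split /= (bigD1 (g s).1) //= big1 => [|i]; last first.
      by rewrite eq_sym => /negPf ->.
    rewrite eqxx mulr1; congr (_ * _).
    rewrite (bigD1 (g s).2) //= big1 => [|i]; last first.
      by rewrite eq_sym => /negPf ->; rewrite muln0.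
    by rewrite eqxx muln1 mulr1.
  rewrite -mulr_sumr sum_monomial ?mulr0 //; apply: leq_ltn_trans lt_rd.
  rewrite exchange_big /= -[X in (_ <= X * _)%N](card_ord r) -sum_nat_const leq_sum // => s _.
  rewrite big_split /= (bigD1 (g s).1) //= big1 => [|i]; last first.
    by rewrite eq_sym => /negPf ->.
  rewrite (bigD1 (g s).2) //= big1 => [|i]; last first.
    by rewrite eq_sym => /negPf ->; rewrite muln0.
  by rewrite !eqxx muln1 !addn0 add1n.
have [[v /andP [v0 /eqP Qv]]|noz] :=
    altP (@existsP _ (fun v : V => (v != 0) && (Q v == 0))); first by exists v.
have Q0 : Q 0 = 0.
  by rewrite QE big1 // => i _; rewrite big1 // => j _; rewrite !mxE mul0r mulr0.
have card0 : \sum_(v : V) 1 = 0 :> F.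
  rewrite sumr_const card_mx mul1n natrX natr_card_finField expr0n.
  by case: k lt_rd.
have : \sum_(v : V) (1 - Q v ^+ r) = 0 by rewrite sumrB card0 sumQ subr0.
(* If 0 is the only zero, only the term at 0 survives and the sum is 1. *)
rewrite (bigD1 0) //= big1 => [|v v0].
  by rewrite Q0 expr0n -[_ == _]negbK -lt0n r0 subr0 addr0 => /eqP; rewrite oner_eq0.
rewrite Q1 ?subrr //; move: noz; rewrite negb_exists => /forallP /(_ v).
by rewrite v0.
Qed.

End Zeros.

(** * Classical generalised quadrangles *)

Section ZerosGeometry.
Variables (F : finFieldType) (k p : nat) (Q : 'rV[F]_k -> F).
Hypothesis qp : #|F|%:R = 0 :> 'F_p.

Let contained (U : {vspace 'rV[F]_k}) := [forall u in U, Q u == 0].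

Lemma contained_sub (U W : {vspace 'rV[F]_k}) : contained W -> (U <= W)%VS -> contained U.
Proof.
by move=> /forall_inP cW /subvP UW; apply/forall_inP => u /UW; apply: cW.
Qed.

Lemma card_line_zeros (l : line (zeros_geometry Q)) : #|[set y | inc y l]| = #|F|.+1.
Proof.
by apply: card_line_subspace_geometry => l' x _ cl _; apply: contained_sub.
Qed.

(** Every nonzero vector of [l] spans a point of the geometry, so [Q] vanishes on [l] and [l] is a
    line of the geometry. *)
Lemma min_words_zeros : min_words_are_lines p (zeros_geometry Q) #|F|.
Proof.
move=> c cC c0 wc.
have [|l [b [l2 lP cE]]] := small_word_subspace_geometry qp _ cC c0 wc.
  by move=> l' x _ cl _; apply: contained_sub.
have lok : (\dim l == 2)%N && contained l.
  rewrite l2; apply/forall_inP => u ul.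
  have [u0|u0] := eqVneq u 0.
    rewrite u0; have v0 : vpick l != 0 by rewrite vpick0 -dimv_eq0 l2.
    have : contained <[vpick l]> by apply: lP; rewrite ?dim_vline ?v0 // -memvE memv_pick.
    by move/forall_inP; apply; apply: mem0v.
  have : contained <[u]> by apply: lP; rewrite ?dim_vline ?u0.
  by move/forall_inP; apply; apply: memv_line.
exists (Sub l lok), b; apply/ffunP => y; rewrite cE !ffunE /=.
by case: (_ <= l)%VS; rewrite [RHS](mulr1, mulr0).
Qed.

Lemma card_point_zeros (A : 'M[F]_k) (r d : nat) :
    (forall v, Q v = \sum_i \sum_j A i j * (v 0 i * v 0 j ^+ d)) ->
    (forall v, Q v != 0 -> Q v ^+ r = 1) ->
    (0 < r)%N -> (r * d.+1 < k * #|F|.-1)%N ->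
  (0 < #|point (zeros_geometry Q)|)%N.
Proof.
move=> QE Q1 r0 lt_rd; have [v v0 Qv] := nontrivial_zero QE Q1 r0 lt_rd.
have vok : (\dim <[v]> == 1)%N && contained <[v]>.
  rewrite dim_vline v0; apply/forall_inP => _ /vlineP [a ->].
  suff -> : Q (a *: v) = a ^+ d.+1 * Q v by rewrite Qv mulr0.
  rewrite !QE mulr_sumr; apply: eq_bigr => i _; rewrite mulr_sumr.
  apply: eq_bigr => j _; rewrite !mxE exprMn exprS.
  by rewrite [RHS]mulrCA; congr (_ * _); rewrite mulrACA.
by apply/card_gt0P; exists (Sub <[v]>%VS vok).
Qed.

End ZerosGeometry.

Lemma card_point_quadric (F : finFieldType) k (A : 'M[F]_k) : (2 < k)%N ->
  (0 < #|point (zeros_geometry (quadratic_form A))|)%N.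
Proof.
move=> k2; have q1 := card_gt1 F.
have q'0 : (0 < #|F|.-1)%N by rewrite -ltnS (ltn_predK q1).
apply: (@card_point_zeros _ _ _ A #|F|.-1 1) => // [v|v v0|].
- rewrite /quadratic_form mxE [RHS]exchange_big /=; apply: eq_bigr => j _.
  rewrite !mxE mulr_suml; apply: eq_bigr => i _.
  by rewrite expr1 mulrCA mulrA.
- by apply: (mulIf v0); rewrite -exprSr (ltn_predK q1) expf_card mul1r.
by rewrite mulnC ltn_mul2r q'0.
Qed.

Lemma card_point_hermitian (K : finFieldType) (theta : {rmorphism K -> K}) k q
    (f : {hermitian_sym 'rV[K]_k for theta}) :
    (1 < k)%N -> #|K| = (q ^ 2)%N -> (forall a, theta a = a ^+ q) ->
  (0 < #|point (zeros_geometry (fun v => f v v))|)%N.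
Proof.
move=> k1 Kq thetaE; have K1 := card_gt1 K.
have q1 : (1 < q)%N by case: q Kq K1 {thetaE} => [|[|q]] // ->.
have q'0 : (0 < q.-1)%N by rewrite -ltnS (ltn_predK q1).
(* The field has q ^ 2 elements, yet [r = q - 1] works: f(v, v) is fixed by [theta], so it equals
   its q-th power. The degree bound is (q - 1)(q + 1) < k (q ^ 2 - 1). *)
apply: (@card_point_zeros _ _ _ (\matrix_(i, j) f (delta_mx 0 i) (delta_mx 0 j)) q.-1 q) => // [v|v v0|].
- rewrite [in LHS](row_sum_delta v) linear_sumlz; apply: eq_bigr => i _.
  rewrite linearZl_LR /= linear_sumr mulr_sumr; apply: eq_bigr => j _.
  by rewrite linearZr_LR /= thetaE mxE [f _ _ * _]mulrC !mulrA.
- apply: (mulIf v0); rewrite -exprSr (ltn_predK q1) mul1r -thetaE.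
  by rewrite [RHS]hermC /= mul1r.
rewrite Kq -!subn1 -[X in (_ * (_ - X))%N](exp1n 2) subn_sqr addn1 -[X in (X < _)%N]mul1n.
by rewrite ltn_mul2r k1 andbT muln_gt0 subn1 q'0.
Qed.

(** * The symplectic quadrangle W(3,q) *)

Section Symplectic.
Variables (F : finFieldType) (p : nat) (f : {skew_symmetric 'rV[F]_4}).
Local Notation V := 'rV[F]_4.
Hypothesis qp : #|F|%:R = 0 :> 'F_p.
Hypothesis f_symp : is_psymplectic f.

Let onL (l : {vspace V}) := (l <= orthov f l)%VS.

(** In characteristic 2 this is part of [is_psymplectic]; otherwise skew symmetry gives 2 f(u, u) =
    0. *)
Lemma symplectic_alt u : f u u = 0.
Proof.
have [_ _ f2] := f_symp; have [/f2 //|N2] := boolP (2 \in [pchar F]).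
have /eqP : f u u = - f u u by rewrite [LHS]hermC /= expr1 mulN1r.
rewrite -addr_eq0 -mulr2n -mulr_natr mulf_eq0 => /orP [/eqP //|/eqP F2].
by case/negP: N2; rewrite inE /= F2 eqxx.
Qed.

(** For [a] and [b] spanning [l], the perp of [a] has dimension 3 and, as [b] is not in the double
    perp of [a], the perps of [a] and [b] meet in dimension 2. The perp of [l] lies in that
    intersection and contains [l]. *)
Lemma orthov_isotropic_line l : \dim l = 2 -> (l <= orthov f l)%VS -> orthov f l = l.
Proof.
move=> l2 lp; have [/eqP rad0 _ _] := f_symp.
pose a := vpick l; have al : a \in l by apply: memv_pick.
have a0 : a != 0 by rewrite vpick0 -dimv_eq0 l2.
have [b bl ba] : exists2 b, b \in l & b \notin <[a]>%VS.
  apply/subvPn; apply/negP => /dimvS; by rewrite l2 dim_vline a0.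
have [w _ aw] : exists2 w, w \in {:V}%VS & f a w != 0.
  by apply/mem_orthovPn; rewrite rad0 memv0.
have a_rad : a \notin orthov f {:V}%VS by rewrite rad0 memv0.
have bNaa : b \notin orthov f (orthov f <[a]>).
  apply: contra ba => /mem_orthovP baa.
  (* Subtracting this multiple of [a] makes [b'] orthogonal to [w] as well as to the perp of [a];
     together these span the space, and the form is non-degenerate. *)
  pose b' := b - (f b w / f a w) *: a.
  suff /eqP : b' = 0 by rewrite subr_eq0 => /eqP ->; rewrite memvZ ?memv_line.
  apply/eqP; rewrite -memv0 -rad0; apply/mem_orthovP => v _.
  pose mu := f a v / f a w; pose u := v - mu *: w.
  have au : f a u = 0 by rewrite linearBr linearZr_LR /= /mu divfK // subrr.
  have ua : u \in orthov f <[a]> by rewrite mem_orthov1 herm_eq0C au.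
  have b'w : f b' w = 0 by rewrite linearBl linearZl_LR /= divfK // subrr.
  have b'u : f b' u = 0 by rewrite linearBl linearZl_LR /= au mulr0 subr0 baa.
  have -> : v = u + mu *: w by rewrite subrK.
  by rewrite linearDr linearZr_LR /= b'u b'w mulr0 addr0.
have d1 := eq_dim_orthov1 a_rad; have d2 := eq_dim_orthov1 bNaa.
rewrite capfv dim_space /= in d1; rewrite -d1 /= in d2.
have : \dim (orthov f <[a]> :&: orthov f <[b]>) = 2 by rewrite -d2.
set ab := (_ :&: _)%VS => ab2.
have lab : (orthov f l <= ab)%VS.
  apply/subvP => u /mem_orthovP ul.
  by rewrite memv_cap !mem_orthov1 !ul ?eqxx.
by apply/eqP; rewrite eq_sym eqEdim lp l2 -ab2 dimvS.
Qed.

(** If [m] and [l] share [u], write [l] as the span of [u] and [v]; a vector of [m] orthogonal to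
    [v] is orthogonal to [u] too, hence to [l]. The converse exchanges the roles, since the perp of
    [m] is [m]. *)
Lemma perp_meets_line l m : \dim l = 2 -> \dim m = 2 -> (m <= orthov f m)%VS ->
  ((m :&: l)%VS != 0%VS) = ((m :&: orthov f l)%VS != 0%VS).
Proof.
have split2 (U W : {vspace V}) : \dim U = 2 -> (U :&: W)%VS != 0%VS ->
    exists u v, [/\ u \in U, u \in W, u != 0, v \in U & U = (<[u]> + <[v]>)%VS].
  move=> U2; rewrite -vpick0; set u := vpick _ => u0.
  have /andP [uU uW] : (u \in U) && (u \in W) by rewrite -memv_cap memv_pick.
  have [v vU vu] : exists2 v, v \in U & v \notin <[u]>%VS.
    by apply/subvPn/negP => /dimvS; rewrite U2 dim_vline u0.
  exists u, v; split=> //; apply/eqP; rewrite eq_sym eqEdim subv_add -!memvE uU vU U2.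
  rewrite dimv_disjoint_sum ?dim_vline ?u0 //.
    by case: eqP vu => // ->; rewrite mem0v.
  rewrite capvC dim1_capE ?dim_vline //.
  by case: eqP vu => // ->; rewrite mem0v.
have meet1 (U : {vspace V}) v : \dim U = 2 -> exists2 w, w \in U & (w != 0) && (f w v == 0).
  move=> U2; have := leq_dim_orthov1 f v U; rewrite U2 /= lt0n dimv_eq0 -vpick0.
  set w := vpick _ => w0; exists w; last rewrite w0 -mem_orthov1.
    by have := memv_pick (U :&: orthov f <[v]>); rewrite memv_cap => /andP [].
  by have := memv_pick (U :&: orthov f <[v]>); rewrite memv_cap => /andP [].
have nz (U W : {vspace V}) w : w \in U -> w \in W -> w != 0 -> (U :&: W)%VS != 0%VS.
  move=> wU wW; apply: contra_neq => UW0; apply/eqP; rewrite -memv0 -UW0.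
  by rewrite memv_cap wU.
move=> l2 m2 mp; have mE := orthov_isotropic_line m2 mp.
apply/idP/idP.
  rewrite capvC => /(split2 _ _ l2) [u [v [ul um _ vl lE]]].
  have [w wm /andP [w0 wv]] := meet1 m v m2.
  apply: (nz _ _ w) => //; rewrite lE mem_orthov_sym subv_add -!memvE.
  rewrite !mem_orthov1 [X in _ && X]herm_eq0C wv andbT.
  by move/orthovP: mp => ->.
move=> /(split2 _ _ m2) [u [v [um ul _ vm mE2]]].
have [w wl /andP [w0 wv]] := meet1 l v l2.
rewrite capvC; apply: (nz _ _ w) => //; rewrite -mE mE2.
rewrite mem_orthov_sym subv_add -!memvE !mem_orthov1 [X in _ && X]herm_eq0C wv.
by rewrite andbT; move/mem_orthovP: ul => ->.
Qed.

(* The difference of the characteristic functions of l and of its perp is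
   orthogonal to the code, but not to l when l is hyperbolic. *)
Lemma min_words_symplectic : min_words_are_lines p (symplectic_geometry f) #|F|.
Proof.
move=> c cC c0 wc.
have [|l [b [l2 _ cE]]] := small_word_subspace_geometry qp _ cC c0 wc; first by [].
have [a aE] := code_sum cC.
have sumE T : \sum_(y : point (symplectic_geometry f) | (val y <= T)%VS) c y
    = b * ((l :&: T)%VS != 0%VS)%:R.
  under eq_bigr => y _ do rewrite cE.
  rewrite -big_mkcondr -(card_points_natr _ qp) sumr_const mulr_natr; congr (_ *+ _).
  rewrite -[RHS](@points_of_subset F 4 predT onL [pred x | (\dim x == 1%N) && (x <= l :&: T)%VS]).
    apply: eq_card => y; rewrite !inE /= subv_cap.
    by rewrite unfold_in; have /andP [-> _] := valP y; rewrite andbC.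
  by move=> x /andP [/eqP].
have b0 : b != 0.
  apply: contraNneq c0 => b0; apply/eqP/ffunP => y; rewrite cE b0 ffunE.
  by case: ifP.
have lp : (l <= orthov f l)%VS.
  have : b * ((l :&: l)%VS != 0%VS)%:R = b * ((l :&: orthov f l)%VS != 0%VS)%:R.
    rewrite -!sumE !(subspace_sum qp _ _ aE) //; apply: eq_bigr => m _.
    by have /andP [/eqP m2 mp] := valP m; rewrite (perp_meets_line l2 m2 mp).
  move/(mulfI b0); rewrite capvv -dimv_eq0 l2 /=.
  have [_|lp0 _] := eqVneq; first by move/eqP; rewrite oner_eq0.
  (* Now [l] is spanned by some [u] in its perp and some [v]; as [f] is alternating, [l] is totally
     isotropic. *)
  move: lp0; rewrite -vpick0; set u := vpick _ => u0.
  have := memv_pick (l :&: orthov f l); rewrite memv_cap -/u => /andP [ul ulp].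
  have [v vl vu] : exists2 v, v \in l & v \notin <[u]>%VS.
    by apply/subvPn/negP => /dimvS; rewrite l2 dim_vline u0.
  have lE : l = (<[u]> + <[v]>)%VS.
    apply/eqP; rewrite eq_sym eqEdim subv_add -!memvE ul vl l2.
    have v0 : v != 0 by case: eqP vu => // ->; rewrite mem0v.
    rewrite dimv_disjoint_sum ?dim_vline ?u0 ?v0 //.
    by rewrite capvC dim1_capE ?dim_vline ?v0.
  apply/orthovP => w w' wl w'l.
  have /memv_addP [_ /vlineP [x ->] [_ /vlineP [y ->] ->]] : w \in (<[u]> + <[v]>)%VS.
    by rewrite -lE.
  have /memv_addP [_ /vlineP [x' ->] [_ /vlineP [y' ->] w'E]] : w' \in (<[u]> + <[v]>)%VS.
    by rewrite -lE.
  rewrite linearDl linearZl_LR /=; move/mem_orthovP: (ulp) => -> //.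
  rewrite mulr0 add0r linearZl_LR /= w'E linearDr !linearZr_LR /= symplectic_alt.
  by rewrite mulr0 addr0 (eqP (_ : f v u == 0)) ?mulr0 // herm_eq0C (mem_orthovP ulp).
have lok : (\dim l == 2)%N && onL l by rewrite l2.
exists (Sub l lok), b; apply/ffunP => y; rewrite cE !ffunE /=.
by case: (_ <= l)%VS; rewrite [RHS](mulr1, mulr0).
Qed.

Lemma card_line_symplectic (l : line (symplectic_geometry f)) :
  #|[set y | inc y l]| = #|F|.+1.
Proof. exact: card_line_subspace_geometry. Qed.

Lemma card_point_symplectic : (0 < #|point (symplectic_geometry f)|)%N.
Proof.
pose e : V := delta_mx 0 0.
have e0 : e != 0 by apply/eqP => /matrixP /(_ 0 0) /eqP; rewrite !mxE oner_eq0.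
have vok : (\dim <[e]> == 1%N) && predT <[e]>%VS by rewrite dim_vline e0.
by apply/card_gt0P; exists (Sub <[e]>%VS vok).
Qed.

End Symplectic.

Lemma classical_repair p h q s t (G : incidence_structure) :
    prime p -> (0 < h)%N -> q = (p ^ h)%N -> generalised_quadrangle s t G ->
    classical_GQ q G ->
  repair_degree (dual (code p G)) = s
  /\ repair_availability (dual (code p G)) = ((p - 1) * (t + 1))%N.
Proof.
move=> p_pr h0 qE G_GQ.
have qp : q%:R = 0 :> 'F_p.
  by rewrite qE natrX (pcharf0 (pchar_Fp p_pr)) expr0n -[_ == _]negbK -lt0n h0.
have concl (F : finFieldType) G' : isomorphic G G' -> (0 < #|point G'|)%N ->
    (forall l : line G', #|[set x | inc x l]| = #|F|.+1) ->
    min_words_are_lines p G' #|F| ->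
  repair_degree (dual (code p G)) = s
  /\ repair_availability (dual (code p G)) = ((p - 1) * (t + 1))%N.
  move=> iso G'0 cardl; apply: (repair_of_isomorphic p_pr G_GQ iso) => //.
  exact: ltnW (card_gt1 F).
case=> [F f Fq f_symp|F A Fq _|F A Fq _|K theta f Kq thetaE _|K theta f Kq thetaE _];
  move=> iso; apply: concl iso _ _ _.
- exact: card_point_symplectic.
- exact: card_line_symplectic.
- by apply: min_words_symplectic f_symp; rewrite Fq.
- exact: card_point_quadric.
- exact: card_line_zeros.
- by apply: min_words_zeros; rewrite Fq.
- exact: card_point_quadric.
- exact: card_line_zeros.
- by apply: min_words_zeros; rewrite Fq.
- exact: card_point_hermitian Kq thetaE.
- exact: card_line_zeros.
- by apply: min_words_zeros; rewrite Kq natrX qp expr0n.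
- exact: card_point_hermitian Kq thetaE.
- exact: card_line_zeros.
- by apply: min_words_zeros; rewrite Kq natrX qp expr0n.
Qed.

(** * Hyperovals *)

(** A polynomial in t of degree at most q - 1 sums over [F] to minus its coefficient of degree q -
    1. The factor [t ^+ e] serves the induction, which expands one affine factor at a time. *)
Lemma sum_exp_prod_affine (F : finFieldType) (s : seq (F * F)) e :
  ((e + size s < #|F|.-1)%N ->
     \sum_(t : F) t ^+ e * \prod_(ab <- s) (ab.1 + t * ab.2) = 0) /\
  ((e + size s = #|F|.-1)%N ->
     \sum_(t : F) t ^+ e * \prod_(ab <- s) (ab.1 + t * ab.2) = - \prod_(ab <- s) ab.2).
Proof.
elim: s e => [|[a b] s IHs] e.
  have sE : \sum_(t : F) t ^+ e * \prod_(ab <- [::]) (ab.1 + t * ab.2) = \sum_(t : F) t ^+ e.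
    by apply: eq_bigr => t _; rewrite big_nil mulr1.
  by rewrite sE addn0 big_nil; split=> [|->]; [apply: sum_exp_lt | apply: sum_exp_pred].
have -> : \sum_(t : F) t ^+ e * \prod_(ab <- (a, b) :: s) (ab.1 + t * ab.2) =
    a * (\sum_(t : F) t ^+ e * \prod_(ab <- s) (ab.1 + t * ab.2))
    + b * (\sum_(t : F) t ^+ e.+1 * \prod_(ab <- s) (ab.1 + t * ab.2)).
  rewrite !mulr_sumr -big_split /=; apply: eq_bigr => t _.
  by rewrite big_cons /= mulrDl mulrDr exprSr !mulrA; congr (_ + _);
     congr (_ * _); rewrite mulrC ?mulrA.
have [IH1 IH2] := IHs e; have [IH3 IH4] := IHs e.+1.
rewrite /= addnS -addSn; split=> size_s.
  by rewrite IH1 ?IH3 ?mulr0 ?addr0 // (leq_ltn_trans _ size_s) // leq_add2r.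
by rewrite IH1 ?IH4 // ?mulr0 ?add0r ?big_cons ?mulrN // -size_s addSn.
Qed.

Section Hyperovals.
Variables (F : finFieldType) (H : {vspace 'rV[F]_4}) (O : {set {vspace 'rV[F]_4}}).
Local Notation V := 'rV[F]_4.
Local Notation q := #|F|.
Local Notation G := (T2star H O).
Implicit Types (x l d D U : {vspace V}) (v u : V) (w : 'cV[F]_4) (ws : seq 'cV[F]_4).

Hypothesis H3 : \dim H = 3.
Hypothesis HO : hyperoval H O.

Definition eval_prod ws v : F := \prod_(w <- ws) (v *m w) 0 0.

Lemma separating_product (Ds : seq {vspace V}) v :
    (forall D, D \in Ds -> v \notin D) ->
  exists ws, [/\ size ws = size Ds, eval_prod ws v != 0
    & forall D u, D \in Ds -> u \in D -> eval_prod ws u = 0].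
Proof.
elim: Ds => [_|D Ds IHs vDs]; first by exists [::]; rewrite /eval_prod big_nil oner_eq0.
have [|ws [sz_ws ws_v ws_0]] := IHs; first by move=> D' D'Ds; rewrite vDs // inE D'Ds orbT.
have [w [wD wv]] := functional_avoiding (vDs D (mem_head _ _)).
exists (w :: ws); split; rewrite ?[size _]/= ?sz_ws //.
  by rewrite /eval_prod big_cons mulf_neq0.
move=> D' u; rewrite inE /eval_prod big_cons => /orP [/eqP -> /wD ->|D'Ds uD'].
  by rewrite mxE mul0r.
by rewrite -/(eval_prod ws u) (ws_0 D') ?mulr0.
Qed.

Lemma hyperplane_functional :
  exists w, forall v, (v \in H) = ((v *m w) 0 0 == 0).
Proof.
have [v _ vH] : exists2 v, v \in {:V}%VS & v \notin H.
  by apply/subvPn/negP => /dimvS; rewrite H3 dim_space.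
have [w [wH wv]] := functional_avoiding vH; exists w => u.
apply/idP/eqP => [/wH ->|wu]; first by rewrite mxE.
have fullE : (H + <[v]>)%VS = {:V}%VS.
  apply/eqP; rewrite eqEdim subvf dim_space addvC dimv_disjoint_sum.
    by rewrite H3 dim_vline; case: eqP vH => // ->; rewrite mem0v.
  by rewrite dim1_capE ?dim_vline //; case: eqP vH => // ->; rewrite mem0v.
have /memv_addP [h hH [_ /vlineP [a ->] uE]] : u \in (H + <[v]>)%VS.
  by rewrite fullE memvf.
move: wu; rewrite uE mulmxDl wH // add0r -scalemxAl mxE => /eqP.
by rewrite mulf_eq0 (negPf wv) orbF => /eqP ->; rewrite scale0r addr0.
Qed.

Section Chart.
Variable eta : 'cV[F]_4.
Hypothesis etaP : forall v, (v \in H) = ((v *m eta) 0 0 == 0).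

(** The representative of an affine point on which [eta] takes the value 1; at a point of [H] it is
    0, the inverse of 0 being 0. *)
Definition chart x : V := ((vpick x *m eta) 0 0)^-1 *: vpick x.

Lemma chart_mem x : chart x \in x.
Proof. by rewrite memvZ ?memv_pick. Qed.

Lemma eta_chart x : \dim x = 1%N -> ~~ (x <= H)%VS -> (chart x *m eta) 0 0 = 1.
Proof.
move=> x1 xH; rewrite -scalemxAl mxE mulVf // -etaP.
by apply: contra xH; rewrite memvE vpick_line.
Qed.

Lemma chart_unique x v : \dim x = 1%N -> v \in x -> (v *m eta) 0 0 = 1 -> v = chart x.
Proof.
move=> x1 vx v1; have v0 : v != 0.
  by apply: contra_eq_neq v1 => ->; rewrite mul0mx mxE eq_sym oner_eq0.
have xE := dim1_line x1 vx v0.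
have /vlineP [a cE] : chart x \in <[v]>%VS by rewrite xE chart_mem.
have : (chart x *m eta) 0 0 = 1.
  by rewrite eta_chart // -xE -memvE etaP v1 oner_eq0.
by rewrite cE -scalemxAl mxE v1 mulr1 => ->; rewrite scale1r.
Qed.

Lemma chart_neq0 x : \dim x = 1%N -> ~~ (x <= H)%VS -> chart x != 0.
Proof.
move=> x1 xH; have := eta_chart x1 xH; apply: contra_eq_neq => ->.
by rewrite mul0mx mxE eq_sym oner_eq0.
Qed.

Lemma affine_line_dims U : \dim U = 2 -> ~~ (U <= H)%VS -> \dim (U :&: H) = 1%N.
Proof.
move=> U2 UH; have [|_] := card_affine_points UH; first by rewrite H3.
by rewrite U2 => -[].
Qed.

Lemma chart_notin x D : \dim x = 1%N -> ~~ (x <= H)%VS -> ~~ (x <= D)%VS -> chart x \notin D.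
Proof.
move=> x1 xH; apply: contra => xD.
by rewrite -(dim1_line x1 (chart_mem x) (chart_neq0 x1 xH)) -memvE.
Qed.

Lemma sum_affine_line U (f : V -> F) : \dim U = 2 -> ~~ (U <= H)%VS ->
  exists u, \sum_(y : point G | (val y <= U)%VS) f (chart (val y))
    = \sum_(t : F) f (u + t *: vpick (U :&: H)%VS).
Proof.
move=> U2 UH; have d1 := affine_line_dims U2 UH.
set d := (U :&: H)%VS in d1 *; set e := vpick d.
have ed : e \in d by apply: memv_pick.
have e0 : e != 0 by rewrite vpick0 dim1_neq0.
have [j ej] : exists j, e 0 j != 0.
  apply/existsP; apply: contraR e0; rewrite negb_exists => /forallP e0.
  by apply/eqP/rowP => j; rewrite mxE; apply/eqP; rewrite -[_ == _]negbK.
have /andP [eU eH] : (e \in U) && (e \in H) by rewrite -memv_cap.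
have e_eta : (e *m eta) 0 0 = 0 by apply/eqP; rewrite -etaP.
have [v vU vH] := subvPn UH.
have veta : (v *m eta) 0 0 != 0 by rewrite -etaP.
pose u := ((v *m eta) 0 0)^-1 *: v.
have uU : u \in U by rewrite memvZ.
have u1 : (u *m eta) 0 0 = 1 by rewrite -scalemxAl mxE mulVf.
have t1 t : ((u + t *: e) *m eta) 0 0 = 1.
  by rewrite mulmxDl mxE -(scalemxAl t) [X in _ + X]mxE u1 e_eta mulr0 addr0.
have t0 t : u + t *: e != 0.
  by apply: contra_eq_neq (t1 t) => ->; rewrite mul0mx mxE eq_sym oner_eq0.
have ptP t : (\dim <[u + t *: e]> == 1%N) && ~~ (<[u + t *: e]> <= H)%VS.
  by rewrite dim_vline t0 -memvE etaP t1 oner_eq0.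
pose pt t : point G := Sub <[u + t *: e]>%VS (ptP t).
exists u; rewrite (reindex pt) /=.
  apply: eq_big => [t|t _]; first by rewrite -memvE memvD ?memvZ.
  by congr f; apply/esym/chart_unique; rewrite ?dim_vline ?t0 ?memv_line ?t1.
exists (fun y : point G => (chart (val y) - u) 0 j / e 0 j) => [t _|y].
  rewrite -(chart_unique (v := u + t *: e)) /= ?dim_vline ?t0 ?memv_line ?t1 //.
  by rewrite addrC addKr mxE mulfK.
rewrite inE => yU; apply/val_inj; rewrite /= /pt.
have /andP [/eqP y1 yH] := valP y.
set x := val y in y1 yH yU *; have xU : chart x \in U.
  exact: subvP yU _ (chart_mem x).
have /vlineP [a aE] : chart x - u \in <[e]>%VS.
  rewrite vpick_line // memv_cap memvB //= etaP mulmxBl.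
  by rewrite mxE [X in _ + X]mxE u1 eta_chart // subrr.
rewrite aE mxE mulfK // -aE addrC subrK.
by apply: dim1_line; rewrite ?chart_mem ?chart_neq0.
Qed.

(** Along [u + t *: e] the product is a polynomial in t whose coefficient of degree [size ws] is its
    value at the direction [e]. In top degree the sum thus sees only the point at infinity of
    [U]. *)
Lemma sum_eval_prod_line ws U : \dim U = 2 -> ~~ (U <= H)%VS ->
  ((size ws < q.-1)%N ->
     \sum_(y : point G | (val y <= U)%VS) eval_prod ws (chart (val y)) = 0) /\
  ((size ws = q.-1)%N ->
     \sum_(y : point G | (val y <= U)%VS) eval_prod ws (chart (val y))
       = - eval_prod ws (vpick (U :&: H)%VS)).
Proof.
move=> U2 UH; have [u ->] := sum_affine_line (eval_prod ws) U2 UH.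
set e := vpick _.
have := sum_exp_prod_affine [seq ((u *m w) 0 0, (e *m w) 0 0) | w <- ws] 0.
rewrite add0n size_map; set L := \sum_t _; set R := \prod_(_ <- _) _.
have -> : R = eval_prod ws e by rewrite /R big_map.
suff -> : L = \sum_t eval_prod ws (u + t *: e) by [].
apply: eq_bigr => t _; rewrite expr0 mul1r big_map; apply: eq_bigr => w _ /=.
by rewrite mulmxDl -scalemxAl [in RHS]mxE [X in _ = _ + X]mxE.
Qed.

End Chart.

Lemma hyperoval_chord a b o : a \in O -> b \in O -> o \in O -> a != b -> a != o -> b != o ->
  ~~ (o <= a + b)%VS.
Proof.
case: HO => _ OP O2 aO bO oO ab ao bo; apply/negP => oab.
have [[a1 _] [b1 _]] := (OP a aO, OP b bO).
have ab2 : \dim (a + b) = 2.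
  rewrite dimv_disjoint_sum ?a1 ?b1 // dim1_capE //.
  by apply: contra ab => ab; rewrite eqEdim ab a1 b1.
have := O2 _ ab2; rewrite leqNgt => /negP []; apply: (@leq_trans #|[set a; b; o]|).
  by rewrite cardsU cards2 ab cards1 (_ : _ :&: _ = set0) ?cards0 //;
     apply/setP => x; rewrite !inE; case: (x =P o) => [->|]; rewrite ?andbF // !(eq_sym o) (negPf ao) (negPf bo).
apply/subset_leq_card/subsetP => x; rewrite !inE -orbA.
by case/or3P => /eqP ->; rewrite ?aO ?bO ?oO ?oab ?addvSl ?addvSr.
Qed.

(** The points of [s] are joined in pairs; by [hyperoval_chord] no chord of two of them passes
    through [o], so half as many linear forms suffice. *)
Lemma hyperoval_pairs o (s : seq {vspace V}) n : o \in O -> size s = n.*2 -> uniq s ->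
    {subset s <= O :\ o} ->
  exists Ds : seq {vspace V}, [/\ size Ds = n, forall D, D \in Ds -> ~~ (o <= D)%VS
    & forall a, a \in s -> exists2 D, D \in Ds & (a <= D)%VS].
Proof.
move=> oO; elim: n s => [|n IHn] [|a [|b s]] //; first by exists [::].
rewrite doubleS => -[sz_s] /= /and3P [abs bs us] sO.
have [//||Ds [szD oD sD]] := IHn s sz_s.
  by move=> x xs; apply: sO; rewrite !inE xs !orbT.
have /setD1P [ao aO] : a \in O :\ o by rewrite sO ?mem_head.
have /setD1P [bo bO] : b \in O :\ o by rewrite sO // !inE eqxx orbT.
have ab : a != b by move: abs; rewrite inE negb_or => /andP [].
exists ((a + b)%VS :: Ds); split; rewrite /= ?szD //.
  by move=> D; rewrite inE => /orP [/eqP ->|/oD //]; apply: hyperoval_chord.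
move=> x; rewrite !inE => /or3P [/eqP ->|/eqP ->|/sD [D DDs xD]].
- by exists (a + b)%VS; rewrite ?mem_head ?addvSl.
- by exists (a + b)%VS; rewrite ?mem_head ?addvSr.
by exists D; rewrite // inE DDs orbT.
Qed.

Hypothesis F2 : 2%:R = 0 :> F.
Hypothesis q_even : ~~ odd q.
Hypothesis q_gt2 : (2 < q)%N.

(** Moves coefficients to [F], where the linear forms take their values; it is additive since 1 + 1
    = 0 in [F]. *)
Definition lift2 (a : 'F_2) : F := (a != 0)%:R.

Lemma lift2_sum (I : finType) (P : pred I) (a : I -> 'F_2) :
  lift2 (\sum_(i | P i) a i) = \sum_(i | P i) lift2 (a i).
Proof.
apply: (big_morph lift2); last by rewrite /lift2 eqxx.
case=> [[|[|//]] x2] [[|[|//]] y2]; rewrite /lift2 -!val_eqE /= ?addr0 ?add0r //.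
Qed.

Lemma lift2_neq0 (a : 'F_2) : a != 0 -> lift2 a = 1.
Proof. by rewrite /lift2 => ->. Qed.

Lemma F2_neq0 (a : 'F_2) : a != 0 -> a = 1.
Proof. by case: a => [[|[|//]] a2] // _; apply: val_inj. Qed.

Lemma min_words_T2star : min_words_are_lines 2 G q.-1.
Proof.
have q1 := card_gt1 F.
move=> c cC c0; rewrite (ltn_predK q1) => wc; have [a aE] := code_sum cC.
have [eta etaP] := hyperplane_functional; pose ht (y : point G) := chart eta (val y).
have ptP (y : point G) : \dim (val y) = 1%N /\ ~~ (val y <= H)%VS.
  by have /andP [/eqP] := valP y.
have lP (l : line G) : [/\ \dim (val l) = 2, ~~ (val l <= H)%VS & (val l :&: H)%VS \in O].
  by have /and3P [/eqP] := valP l.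
pose sigma o := \sum_(l : line G | (val l :&: H)%VS == o) lift2 (a l).
pose pair ws := \sum_y lift2 (c y) * eval_prod ws (ht y).
have pairE ws : pair ws = \sum_l lift2 (a l) * \sum_(y | inc y l) eval_prod ws (ht y).
  rewrite /pair; under eq_bigr => y _ do rewrite aE lift2_sum mulr_suml.
  rewrite (exchange_big_dep predT) //=; apply: eq_bigr => l _.
  by rewrite mulr_sumr.
have pair_low ws : (size ws < q.-1)%N -> pair ws = 0.
  move=> sz; rewrite pairE big1 // => l _; have [l2 lH _] := lP l.
  by have [-> //] := sum_eval_prod_line etaP ws l2 lH; rewrite mulr0.
have pair_top ws : size ws = q.-1 ->
    pair ws = - \sum_(o in O) sigma o * eval_prod ws (vpick o).
  move=> sz; rewrite pairE -sumrN.
  rewrite (partition_big (fun l : line G => (val l :&: H)%VS) (mem O)) /=; last first.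
    by move=> l _; have [] := lP l.
  apply: eq_bigr => o _; rewrite /sigma mulr_suml -sumrN; apply: eq_bigr => l /eqP <-.
  have [l2 lH _] := lP l.
  by have [_ -> //] := sum_eval_prod_line etaP ws l2 lH; rewrite mulrN.
pose S : {set {vspace V}} := [set val y | y in [set y | c y != 0]].
have cardS : (#|S| <= q)%N by rewrite card_imset //; apply: val_inj.
have SP (y : point G) : (val y \in S) = (c y != 0).
  by rewrite mem_imset ?inE //; apply: val_inj.
have S1 x : x \in S -> \dim x = 1%N /\ ~~ (x <= H)%VS.
  by case/imsetP => y _ ->; apply: ptP.
have line_eq := @dim1_eq F 4.
(* Products of fewer than q - 1 linear forms are orthogonal to c, so they cannot
   vanish at all points of S but one. *)
have no_cover x (Ds : seq {vspace V}) : x \in S -> (size Ds < q.-1)%N ->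
    (forall D, D \in Ds -> ~~ (x <= D)%VS) ->
    (forall x', x' \in S -> x' != x -> exists2 D, D \in Ds & (x' <= D)%VS) -> False.
  move=> xS sz xDs cover; have [x1 xH] := S1 x xS.
  have [|ws [szw wsx ws0]] := separating_product (Ds := Ds) (v := chart eta x).
    by move=> D DDs; apply: (chart_notin etaP x1 xH (xDs D DDs)).
  have := pair_low ws; rewrite szw => /(_ sz) /eqP.
  have /imsetP [y] := xS; rewrite inE => cy xE.
  rewrite /pair (bigD1 y) //= big1 => [|y' y'y].
    by rewrite addr0 lift2_neq0 // mul1r /ht -xE (negPf wsx).
  have [->|cy'] := eqVneq (c y') 0; first by rewrite /lift2 eqxx mul0r.
  have [||D DDs y'D] := cover (val y'); first by rewrite SP.
    by rewrite xE; apply: contra y'y => /eqP/val_inj ->.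
  by rewrite (ws0 D) ?mulr0 //; apply: subvP y'D _ (chart_mem _ _).
have [x0 x0S] : exists x, x \in S.
  apply/set0Pn; apply: contraNneq c0 => S0; apply/eqP/ffunP => y; rewrite ffunE.
  by apply/eqP; rewrite -[_ == _]negbK -SP S0 inE.
(* If [S] had fewer than q points, at most q - 2 would differ from [x0], and each could get a form
   of its own. *)
have cardSq : #|S| = q.
  apply/eqP; rewrite eqn_leq cardS leqNgt; apply/negP => lt_Sq.
  apply: (no_cover x0 (enum (S :\ x0))) => //.
  - rewrite -cardE -ltnS (ltn_predK q1); apply: leq_ltn_trans lt_Sq.
    by rewrite (cardsD1 x0 S) x0S.
  - move=> D; rewrite mem_enum => /setD1P [Dx0 DS].
    apply: contra Dx0 => x0D; rewrite (line_eq x0 D) //.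
      by have [] := S1 x0 x0S.
    by have [] := S1 D DS.
  by move=> x xS xx0; exists x; rewrite ?subvv // mem_enum !inE xx0.
(* Covering [y] and [z] by a single form, zero on [y + z], saves one form: q - 2 are used. *)
have collinear x y z : x \in S -> y \in S -> z \in S -> x != y -> x != z -> y != z ->
    (x <= y + z)%VS.
  move=> xS yS zS xy xz yz; apply: contraT => xyz; exfalso.
  apply: (no_cover x ((y + z)%VS :: enum (S :\ x :\ y :\ z))) => //.
  - rewrite /= -cardE -ltnS (ltn_predK q1) -cardSq (cardsD1 x S) xS !add1n !ltnS.
    rewrite (cardsD1 y (S :\ x)) !inE eq_sym xy yS.
    by rewrite (cardsD1 z (S :\ x :\ y)) !inE eq_sym yz eq_sym xz zS.
  - move=> D; rewrite inE mem_enum => /orP [/eqP -> //|].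
    rewrite !inE => /and4P [_ _ Dx DS]; apply: contra Dx => xD.
    by rewrite (line_eq x D) //; [have [] := S1 x xS | have [] := S1 D DS].
  move=> x' x'S x'x; have [->|x'z] := eqVneq x' z.
    by exists (y + z)%VS; rewrite ?mem_head ?addvSr.
  have [->|x'y] := eqVneq x' y.
    by exists (y + z)%VS; rewrite ?mem_head ?addvSl.
  by exists x'; rewrite ?subvv // inE mem_enum !inE x'z x'y x'x x'S orbT.
have [x1 /setD1P [x1x0 x1S]] : exists x, x \in S :\ x0.
  by apply/set0Pn; rewrite -card_gt0 -ltnS; move: cardSq; rewrite (cardsD1 x0 S) x0S add1n => ->.
have [dx0 x0H] := S1 x0 x0S; have [dx1 _] := S1 x1 x1S.
pose l := (x0 + x1)%VS.
have l2 : \dim l = 2.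
  rewrite dimv_disjoint_sum ?dx0 ?dx1 // dim1_capE //.
  by apply: contra x1x0 => x01; rewrite (line_eq x0 x1).
have lH : ~~ (l <= H)%VS by apply: contra x0H; apply: subv_trans (addvSl _ _).
set d := (l :&: H)%VS; have d1 : \dim d = 1%N by apply: affine_line_dims.
have SE : S = [set x | [&& \dim x == 1%N, (x <= l)%VS & ~~ (x <= H)%VS]].
  have [|cl _] := card_affine_points lH; first by rewrite H3.
  apply/eqP; rewrite eqEcard cl -/d d1 expn1 cardSq leqnn andbT.
  apply/subsetP => x xS; have [dx xH] := S1 x xS; rewrite inE dx xH andbT /=.
  have [->|xx0] := eqVneq x x0; first exact: addvSl.
  have [->|xx1] := eqVneq x x1; first exact: addvSr.
  by rewrite collinear // eq_sym.
have cE y : c y = if (val y <= l)%VS then 1 else 0.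
  have := SP y; rewrite SE inE; have [-> ->] := ptP y; rewrite andbT /= => ->.
  by have [->|/F2_neq0 ->] := eqVneq (c y) 0.
suff dO : d \in O.
  have lok : [&& (\dim l == 2)%N, ~~ (l <= H)%VS & (l :&: H)%VS \in O] by rewrite l2 lH.
  exists (Sub l lok), 1; apply/ffunP => y; rewrite scale1r ffunE cE /=.
  by case: (_ <= l)%VS.
have [cardO OP O2] := HO.
apply: contraT => dO.
(* Evaluation at d is a combination of the evaluations at the points of O; a
   product of forms that vanishes at d and on O except at o shows that the
   coefficient of o is zero. It exists because q / 2 + 1 <= q - 1. *)
have dE ws : size ws = q.-1 ->
    eval_prod ws (vpick d) = \sum_(o in O) sigma o * eval_prod ws (vpick o).
  move=> sz; apply: oppr_inj; rewrite -pair_top //.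
  have [_ <- //] := sum_eval_prod_line etaP ws l2 lH.
  rewrite [LHS]big_mkcond /pair; apply: eq_bigr => y _; rewrite cE.
  by case: ifP => _; rewrite /lift2 ?oner_eq0 ?eqxx ?mul1r ?mul0r.
(* Zero subspaces add forms that are only required not to vanish at [v], which brings their number
   to exactly q - 1. *)
have padding v (Ds : seq {vspace V}) : v != 0 -> (size Ds <= q.-1)%N ->
    (forall D, D \in Ds -> v \notin D) ->
  exists ws, [/\ size ws = q.-1, eval_prod ws v != 0
    & forall D u, D \in Ds -> u \in D -> eval_prod ws u = 0].
  move=> v0 sz vDs.
  have [|ws [szw wsv ws0]] := separating_product (Ds := Ds ++ nseq (q.-1 - size Ds) 0%VS) (v := v).
    by move=> D; rewrite mem_cat => /orP [/vDs //|/nseqP [-> _]]; rewrite memv0.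
  exists ws; split=> //; first by rewrite szw size_cat size_nseq subnKC.
  by move=> D u DDs; apply: ws0; rewrite mem_cat DDs.
have line_notin o D : \dim o = 1%N -> ~~ (o <= D)%VS -> vpick o \notin D.
  by move=> o1; apply: contra => oD; rewrite -(vpick_line o1) -memvE.
have sigma0 o : o \in O -> sigma o = 0.
  move=> oO; have [o1 _] := OP o oO.
  have od : o != d by apply: contraNneq dO => <-.
  have dim_od x x' : \dim x = 1%N -> \dim x' = 1%N -> x != x' -> \dim (x + x') = 2.
    move=> dx dx' xx'; rewrite dimv_disjoint_sum ?dx ?dx' // dim1_capE //.
    by apply: contra xx' => xx'; rewrite (line_eq x x').
  (* If every [b] failed, all q + 2 points of [O] would lie on the line [o + d]. *)
  have [b /andP [/setD1P [bo bO] obd]] :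
      exists b, (b \in O :\ o) && ~~ (o <= b + d)%VS.
    apply/existsP; apply: contraT; rewrite negb_exists => /forallP all_od.
    have := O2 _ (dim_od o d o1 d1 od); rewrite leqNgt => /negP [].
    apply: (@leq_trans #|O|); first by rewrite cardO addn2 !ltnS ltnW.
    apply/subset_leq_card/subsetP => b bO; rewrite inE bO /=.
    have [->|bo] := eqVneq b o; first exact: addvSl.
    have := all_od b; rewrite !inE bo bO /= negbK => obd.
    have [b1 _] := OP b bO; have bd : b != d by apply: contraNneq dO => <-.
    have /eqP -> : (o + d == b + d)%VS; last exact: addvSl.
    by rewrite eqEdim subv_add obd addvSr !dim_od.
  (* The q points of [O] other than [o] and [b] are covered by q / 2 chords; the line [b + d] takes
     care of [b] and of [d]. *)
  have [Ds [szD oD OD]] : exists Ds : seq {vspace V}, [/\ size Ds = q./2,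
      forall D, D \in Ds -> ~~ (o <= D)%VS
      & forall x, x \in enum (O :\ o :\ b) -> exists2 D, D \in Ds & (x <= D)%VS].
    apply: (hyperoval_pairs oO _ (enum_uniq _)).
      rewrite -cardE even_halfK //; apply: (@addnI 2); rewrite [RHS]addnC -cardO.
      by rewrite (cardsD1 o O) oO (cardsD1 b (O :\ o)) !inE bo bO.
    by move=> x; rewrite mem_enum => /setD1P [].
  have [|||ws [szw wso ws0]] := padding (vpick o) ((b + d)%VS :: Ds).
  - by rewrite vpick0 dim1_neq0.
  - have half_lt n m : n.*2 = m -> (2 < m)%N -> (n < m.-1)%N.
      by move=> <-; case: n => [|[|n]] // _; rewrite !doubleS /= !ltnS -addnn leq_addr.
    by rewrite /= szD half_lt ?even_halfK.
  - by move=> D; rewrite inE => /orP [/eqP ->|/oD]; apply: line_notin.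
  have := dE ws szw; rewrite (ws0 (b + d)%VS) ?mem_head //; last first.
    exact: subvP (addvSr _ _) _ (memv_pick _).
  rewrite (bigD1 o) //= big1 ?addr0 => [/esym/eqP|x /andP [xO xo]].
    by rewrite mulf_eq0 (negPf wso) orbF => /eqP.
  have [->|xb] := eqVneq x b.
    by rewrite (ws0 (b + d)%VS) ?mulr0 ?mem_head //; apply: subvP (addvSl _ _) _ (memv_pick _).
  have [|D DDs xD] := OD x; first by rewrite mem_enum !inE xb xo.
  rewrite (ws0 D) ?mulr0 ?inE ?DDs ?orbT //.
  exact: subvP xD _ (memv_pick _).
(* All [sigma o] are zero, so every product of q - 1 forms would vanish at [d]; this one does
   not. *)
have [||//|ws [szw wsd _]] := padding (vpick d) [::]; first by rewrite vpick0 dim1_neq0.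
  by [].
case/eqP: wsd; rewrite dE // big1 // => o oO.
by rewrite sigma0 ?mul0r.
Qed.

Lemma card_line_T2star (l : line G) : #|[set y | inc y l]| = q.-1.+1.
Proof.
have /and3P [/eqP l2 lH lO] := valP l; rewrite (ltn_predK (card_gt1 F)).
have [|cl _] := card_affine_points lH; first by rewrite H3.
rewrite -[RHS]expn1 -(affine_line_dims l2 lH) -cl.
rewrite -(@card_sig_set _ [pred x | (\dim x == 1%N) && ~~ (x <= H)%VS] [pred x | [&& \dim x == 1%N, (x <= val l)%VS & ~~ (x <= H)%VS]]).
  apply: eq_card => y; rewrite !inE /=.
  by have /andP [-> ->] := valP y; rewrite andbT.
by move=> x /and3P [/= -> _ ->].
Qed.

Lemma card_point_T2star : (0 < #|point G|)%N.
Proof.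
have [v _ vH] : exists2 v, v \in {:V}%VS & v \notin H.
  by apply/subvPn/negP => /dimvS; rewrite H3 dim_space.
have v0 : v != 0 by apply: contraNneq vH => ->; rewrite mem0v.
have vok : (\dim <[v]> == 1%N) && ~~ (<[v]> <= H)%VS by rewrite dim_vline v0 -memvE.
by apply/card_gt0P; exists (Sub <[v]>%VS vok).
Qed.

End Hyperovals.

Lemma T2star_repair p h q s t (G : incidence_structure) :
    prime p -> q = (p ^ h)%N -> ~~ odd q -> (2 < q)%N ->
    generalised_quadrangle s t G -> T2star_GQ q G ->
  repair_degree (dual (code p G)) = s
  /\ repair_availability (dual (code p G)) = ((p - 1) * (t + 1))%N.
Proof.
move=> p_pr qE q_even q2 G_GQ [F [H [O [Fq H3 HO iso]]]].
have p2 : p = 2.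
  by apply/eqP; case: (even_prime p_pr) => [->//|po]; rewrite qE oddX po orbT in q_even.
rewrite p2 in p_pr qE *; rewrite -Fq in q_even q2 qE.
have F2 : 2%:R = 0 :> F.
  by have := card_finPcharP qE p_pr; rewrite inE => /andP [_ /eqP].
apply: (repair_of_isomorphic (s' := #|F|.-1) p_pr G_GQ iso).
- exact: card_point_T2star H3.
- by rewrite -ltnS (ltn_predK q2) ltnW.
- exact: card_line_T2star H3.
exact: min_words_T2star H3 HO F2 q_even q2.
Qed.

(** * Translation generalised quadrangles *)

Lemma gq_isomorphic s t (G G' : incidence_structure) :
  isomorphic G G' -> generalised_quadrangle s t G -> generalised_quadrangle s t G'.
Proof.
move=> [f [g [[f1 fK f1K] [g1 gK g1K] fgE]]] [pp ll lp pl ax].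
have incE x l : inc x l = inc (f1 x) (g1 l) by rewrite -fgE f1K g1K.
have f1_inj := can_inj f1K; have g1_inj := can_inj g1K.
have cardP (P : pred (point G)) (P' : pred (point G')) :
    (forall x, P' x = P (f1 x)) -> #|[set x | P' x]| = #|[set x | P x]|.
  move=> PP'; rewrite -(card_imset _ f1_inj); apply: eq_card => x; rewrite inE.
  apply/imsetP/idP => [[y]|Px]; first by rewrite inE PP' => Py ->.
  by exists (f x); rewrite ?fK // inE PP' fK.
have cardL (P : pred (line G)) (P' : pred (line G')) :
    (forall l, P' l = P (g1 l)) -> #|[set l | P' l]| = #|[set l | P l]|.
  move=> PP'; rewrite -(card_imset _ g1_inj); apply: eq_card => l; rewrite inE.
  apply/imsetP/idP => [[y]|Px]; first by rewrite inE PP' => Py ->.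
  by exists (g l); rewrite ?gK // inE PP' gK.
split.
- move=> x y xy; rewrite (cardL (fun l => inc (f1 x) l && inc (f1 y) l)).
    by apply: pp; rewrite (inj_eq f1_inj).
  by move=> l; rewrite !incE.
- move=> l l' ll'; rewrite (cardP (fun x => inc x (g1 l) && inc x (g1 l'))).
    by apply: ll; rewrite (inj_eq g1_inj).
  by move=> x; rewrite !incE.
- by move=> l; rewrite (cardP (fun x => inc x (g1 l))) // => x; rewrite incE.
- by move=> x; rewrite (cardL (fun l => inc (f1 x) l)) // => l; rewrite incE.
move=> x l; rewrite incE => /ax <-.
rewrite (cardL (fun l' => inc (f1 x) l' && [exists y, inc y l' && inc y (g1 l)])) //.
move=> l'; rewrite incE; congr (_ && _); apply/existsP/existsP => -[y].
  by rewrite !incE => yl; exists (f1 y).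
by move=> yl; exists (f y); rewrite !incE fK.
Qed.

(** * Line sums in a quadrangle whose order vanishes modulo p *)

Section Quadrangle.
Variables (p s t : nat) (G : incidence_structure).
Hypothesis G_GQ : generalised_quadrangle s t G.
Hypothesis s0 : s%:R = 0 :> 'F_p.
Hypothesis t0 : t%:R = 0 :> 'F_p.

(** If [x] is on [m], then [m] counts s + 1 and the t other lines through [x] count 1 each;
    otherwise exactly one line through [x] meets [m], in one point. *)
Lemma sum_meets (x : point G) (m : line G) :
  (\sum_(l | inc x l) #|[set y | inc y l & inc y m]|)%:R = 1 :> 'F_p.
Proof.
have [_ ll lp pl ax] := G_GQ; have [xm|xm] := boolP (inc x m).
  rewrite (bigD1 m) //= (eq_bigr (fun=> 1%N)) => [|l /andP [xl lm]]; last first.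
    apply/eqP; rewrite eqn_leq ll //=; apply/card_gt0P; exists x.
    by rewrite inE xl xm.
  have -> : [set y | inc y m & inc y m] = [set y | inc y m].
    by apply/setP => y; rewrite !inE andbb.
  have := pl x; rewrite (cardsD1 m) inE xm add1n => -[tE].
  rewrite lp sum1_card (_ : #|_| = t); last first.
    by rewrite -tE; apply: eq_card => l; rewrite !inE unfold_in andbC.
  by rewrite natrD t0 addr0 -natr1 s0 add0r.
rewrite (eq_bigr (fun l => nat_of_bool [exists y, inc y l && inc y m])) => [|l xl].
  have := ax x m xm; rewrite -sum1dep_card big_mkcondr /= => axE.
  rewrite (eq_bigr (fun l => if [exists y, inc y l && inc y m] then 1%N else 0%N)) ?axE //.
have lm : l != m by apply: contraNneq xm => <-.
apply/eqP; rewrite eqn_leq; apply/andP; split.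
  case: existsP => [_|no]; first exact: ll.
  rewrite leqn0 cards_eq0; apply/eqP/setP => y; rewrite !inE.
  by apply/negP => ylm; apply: no; exists y.
case: existsP => [[y ylm]|//]; apply/card_gt0P; exists y.
by rewrite inE.
Qed.

(** By [sum_meets] each coefficient is counted once modulo p. The total does not depend on [x],
    which ties together the values of [c] around different points. *)
Lemma sum_lines_through (c : {ffun point G -> ('F_p)^o}) (a : line G -> 'F_p) x :
    (forall y, c y = \sum_(l | inc y l) a l) ->
  \sum_(l | inc x l) \sum_(y | inc y l) c y = \sum_l a l.
Proof.
move=> cE.
under eq_bigr => l _.
  under eq_bigr => y _ do rewrite cE.
  rewrite (exchange_big_dep predT) //=; over.
rewrite exchange_big /=; apply: eq_bigr => m _.
rewrite -[RHS]mulr1 -(sum_meets x m) natr_sum mulr_sumr; apply: eq_bigr => l _.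
rewrite sumr_const mulr_natr; congr (_ *+ _).
by apply: eq_card => y; rewrite !inE.
Qed.

End Quadrangle.

(* Dimensions and cardinals are generalised first, lest lia compare them up to
   conversion. *)
Ltac nat_lia :=
  repeat match goal with
  | |- context [@dimv ?K ?vT ?U] => generalize (@dimv K vT U)
  | |- context [@card.body ?T ?A] => generalize (@card.body T A)
  | |- context [nat_of_bool ?b] =>
      lazymatch b with true => fail | false => fail | _ => generalize (nat_of_bool b) end
  end; clear; lia.

(** * The quadrangle T(E) of an egg and its dual words *)

Section Eggs.
Variables (F : finFieldType) (n m p : nat).
Local Notation V := 'rV[F]_(2 * n + m + 1).
Local Notation q := #|F|.
Variables (H : {vspace V}) (E : {set {vspace V}}).
Local Notation G := (T_egg H E).
Local Notation word := {ffun point G -> ('F_p)^o}.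
Implicit Types (x l d D M K X Y : {vspace V}) (v u : V) (c : word) (U : tangent_point H E).

Hypothesis n_gt0 : (0 < n)%N.
Hypothesis m_gt0 : (0 < m)%N.
Hypothesis H_dim : \dim H = (2 * n + m)%N.
Hypothesis E_egg : egg H E.
Hypothesis G_GQ : generalised_quadrangle (q ^ n) (q ^ m) G.
Hypothesis qp : q%:R = 0 :> 'F_p.

Definition aff (P : affine_point H) : point G := inl (inl P).
Definition tan (U : tangent_point H E) : point G := inl (inr U).
Definition infp : point G := inr tt.
Definition aline (L : affine_line H E) : line G := inl L.
Definition eline (X : egg_line E) : line G := inr X.

Lemma sum_point (T : nmodType) (P : pred (point G)) (f : point G -> T) :
  \sum_(y | P y) f y = \sum_(x | P (aff x)) f (aff x) + \sum_(U | P (tan U)) f (tan U)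
                       + (if P infp then f infp else 0).
Proof.
rewrite big_mkcond big_sumType big_sumType /=; congr (_ + _ + _).
- by rewrite [RHS]big_mkcond.
- by rewrite [RHS]big_mkcond.
by rewrite (big_pred1 tt) // => -[].
Qed.

Lemma sum_line (T : nmodType) (P : pred (line G)) (f : line G -> T) :
  \sum_(l | P l) f l = \sum_(L | P (aline L)) f (aline L) + \sum_(X | P (eline X)) f (eline X).
Proof. by rewrite big_mkcond big_sumType /= -!big_mkcond. Qed.

Lemma card_egg : #|E| = (q ^ m + 1)%N. Proof. by case: E_egg. Qed.

Lemma egg_dim X : X \in E -> \dim X = n.
Proof. by case: E_egg => _ + _ _ => /(_ X) EX /EX []. Qed.

Lemma egg_sub X : X \in E -> (X <= H)%VS.
Proof. by case: E_egg => _ + _ _ => /(_ X) EX /EX []. Qed.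

Lemma natr_expq e : (0 < e)%N -> (q ^ e)%:R = 0 :> 'F_p.
Proof. by move=> e0; rewrite natrX qp expr0n -[_ == _]negbK -lt0n e0. Qed.

Lemma natr_expq_eq0 e : (q ^ e)%:R = (e == 0%N)%:R :> 'F_p.
Proof. by case: e => // e; rewrite natr_expq. Qed.

Lemma aff_dim (P : affine_point H) : \dim (val P) = 1%N.
Proof. by have /andP [/eqP] := valP P. Qed.

Lemma aff_notin (P : affine_point H) : ~~ (val P <= H)%VS.
Proof. by have /andP [] := valP P. Qed.

Lemma hyp_dim : (2 * n + m + 1 <= (\dim H).+1)%N.
Proof. by rewrite H_dim addn1. Qed.

Lemma dim_capH M : ~~ (M <= H)%VS -> \dim M = (\dim (M :&: H)).+1.
Proof. by move=> MH; have [] := card_affine_points MH hyp_dim. Qed.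

Lemma card_aff M : ~~ (M <= H)%VS ->
  #|[set P : affine_point H | (val P <= M)%VS]| = (q ^ \dim (M :&: H))%N.
Proof.
move=> MH; have [<- _] := card_affine_points MH hyp_dim.
rewrite -(@card_sig_set _ [pred x | (\dim x == 1%N) && ~~ (x <= H)%VS]
  [pred x | [&& \dim x == 1%N, (x <= M)%VS & ~~ (x <= H)%VS]]).
  by apply: eq_card => P; rewrite !inE /= aff_dim aff_notin andbT.
by move=> x /and3P [/= -> _ ->].
Qed.

Lemma aline_egg (L : affine_line H E) : (val L :&: H)%VS \in E.
Proof. by have /andP [] := valP L. Qed.

Lemma aline_dim (L : affine_line H E) : \dim (val L) = n.+1.
Proof. by have /andP [/eqP -> _] := valP L; rewrite addn1. Qed.

Lemma aline_notin (L : affine_line H E) : ~~ (val L <= H)%VS.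
Proof.
apply/negP => /capv_idPl LH; have := egg_dim (aline_egg L).
by rewrite LH aline_dim => /eqP; rewrite -[X in _ == X]addn0 -addn1 eqn_add2l.
Qed.

(* The egg element at which U is tangent; the default 0 is never taken. *)
Definition eg (U : tangent_point H E) : {vspace V} :=
  odflt 0%VS [pick X in E | tangent_space H E X (val U :&: H)%VS].

Lemma egP (U : tangent_point H E) : eg U \in E /\ tangent_space H E (eg U) (val U :&: H)%VS.
Proof.
rewrite /eg; case: pickP => [X /andP []//|no].
have /andP [_ /existsP [X /andP [XE tX]]] := valP U.
by have := no X; rewrite XE tX.
Qed.

Lemma tan_dim (U : tangent_point H E) : \dim (val U) = (n + m).+1.
Proof. by have /andP [/eqP -> _] := valP U; rewrite addn1. Qed.

Lemma tan_capH_dim (U : tangent_point H E) : \dim (val U :&: H) = (n + m)%N.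
Proof. by have [_ /and4P [_ /eqP]] := egP U. Qed.

Lemma eg_sub (U : tangent_point H E) : (eg U <= val U)%VS.
Proof. by have [_ /and4P [_ _ eU _]] := egP U; apply: subv_trans eU (capvSl _ _). Qed.

Lemma eg_unique (U : tangent_point H E) X : X \in E -> (X <= val U)%VS -> X = eg U.
Proof.
move=> XE XU; have [_ /and4P [_ _ _ /forall_inP tU]] := egP U.
apply/eqP; have := tU X XE; case: eqP => //= _ /eqP TX.
have : \dim X = 0%N.
  apply/eqP; rewrite dimv_eq0 -subv0 -TX subv_cap subvv andbT.
  by rewrite subv_cap XU egg_sub.
by rewrite egg_dim // => n0; have := n_gt0; rewrite n0.
Qed.

Lemma sub_eg (U : tangent_point H E) X : X \in E -> (X <= val U)%VS = (eg U == X).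
Proof.
move=> XE; apply/idP/eqP => [/eg_unique -> //|<-].
exact: eg_sub.
Qed.

Lemma card_line_points_T (l : line G) :
  #|[set y | inc y l]| = (#|[set x | inc (aff x) l]| + #|[set U | inc (tan U) l]|
                          + inc infp l)%N.
Proof.
by rewrite -sum1dep_card sum_point !sum1dep_card.
Qed.

(** Read off from the order: a line of type (b) has q ^ n + 1 points, all of type (ii) except
    (infty). *)
Lemma card_tan_egg X : X \in E -> #|[set U : tangent_point H E | (X <= val U)%VS]| = (q ^ n)%N.
Proof.
move=> XE; have [_ _ /(_ (eline (Sub X XE))) + _ _] := G_GQ.
rewrite card_line_points_T (_ : [set x | _] = set0) ?cards0; last first.
  by apply/setP => x; rewrite !inE.
rewrite add0n => cE; apply: (@addIn 1); rewrite [RHS]addn1; exact: cE.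
Qed.

Lemma card_tan_aline (L : affine_line H E) :
  #|[set U : tangent_point H E | (val L <= val U)%VS]| = 1%N.
Proof.
have [_ _ /(_ (aline L)) + _ _] := G_GQ.
rewrite card_line_points_T /= card_aff ?aline_notin // egg_dim ?aline_egg //.
rewrite addn0 => cE; apply: (@addnI (q ^ n)%N); rewrite [RHS]addn1; exact: cE.
Qed.

Lemma tan_aline (L : affine_line H E) :
  exists2 U, (val L <= val U)%VS & forall U', (val L <= val U')%VS -> U' = U.
Proof.
have /eqP/cards1P [U UE] := card_tan_aline L; exists U.
  by have := set11 U; rewrite -UE inE.
by move=> U' LU'; apply/set1P; rewrite -UE inE.
Qed.

Lemma tan_aline_eg (L : affine_line H E) (U : tangent_point H E) :
  (val L <= val U)%VS -> eg U = (val L :&: H)%VS.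
Proof.
move=> LU; apply/esym/eg_unique; first exact: aline_egg.
exact: subv_trans (capvSl _ _) LU.
Qed.

Lemma aline_through (P : affine_point H) X : X \in E ->
  exists2 L : affine_line H E, val L = (val P + X)%VS & (val L :&: H)%VS = X.
Proof.
move=> XE; have PX : (val P :&: X = 0)%VS.
  apply: dim1_capE; first exact: aff_dim.
  by apply: contra (aff_notin P) => /subv_trans; apply; apply: egg_sub.
have LH : ~~ ((val P + X)%VS <= H)%VS.
  by apply: contra (aff_notin P); apply: subv_trans (addvSl _ _).
have dL : \dim (val P + X) = n.+1 by rewrite dimv_disjoint_sum // aff_dim egg_dim.
have XE' : ((val P + X) :&: H)%VS = X.
  apply/esym/eqP; rewrite eqEdim subv_cap addvSr egg_sub //=.
  by rewrite (egg_dim XE) -ltnS -dim_capH ?dL.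
have ok : (\dim (val P + X) == n + 1)%N && (((val P + X) :&: H)%VS \in E).
  by rewrite dL addn1 eqxx XE'.
by exists (Sub (val P + X)%VS ok).
Qed.

(** The point [P] and the common egg element span a line of type (a), which lies in a single point
    of type (ii). *)
Lemma tan_unique_through (P : affine_point H) (U U' : tangent_point H E) :
  (val P <= val U)%VS -> (val P <= val U')%VS -> eg U = eg U' -> U = U'.
Proof.
move=> PU PU' ee; have [L LE _] := aline_through P (proj1 (egP U)).
have [U0 _ uniq] := tan_aline L.
have LU : (val L <= val U)%VS by rewrite LE subv_add PU eg_sub.
have LU' : (val L <= val U')%VS by rewrite LE subv_add PU' ee eg_sub.
by rewrite (uniq U LU) (uniq U' LU').
Qed.

(** If [M] meets [L] in an affine point, the number is q ^ e with e the dimension of the common part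
    at infinity, hence 1 modulo p only for e = 0. Otherwise it is 0, and the dimension of [M] forces
    [M] and [L] to meet inside [H]. *)
Lemma count_affine_line (L : affine_line H E) M : ~~ (M <= H)%VS -> (n + m < \dim M)%N ->
  #|[set P : affine_point H | (val P <= val L)%VS && (val P <= M)%VS]|%:R
    = ((M :&: (val L :&: H))%VS == 0%VS)%:R :> 'F_p.
Proof.
move=> MH dM.
have -> : [set P : affine_point H | (val P <= val L)%VS && (val P <= M)%VS] =
    [set P : affine_point H | (val P <= M :&: val L)%VS].
  by apply/setP => P; rewrite !inE subv_cap andbC.
rewrite capvA; have [LMH|LMH] := boolP ((M :&: val L)%VS <= H)%VS; last first.
  by rewrite card_aff // natr_expq_eq0 dimv_eq0.
rewrite (_ : [set _ | _] = set0) ?cards0; last first.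
  apply/setP => P; rewrite !inE; apply/negP => PLM.
  by case/negP: (aff_notin P); apply: subv_trans LMH.
rewrite (capv_idPl LMH) -dimv_eq0; case: eqP => // ML0.
have := dimv_sum_cap M (val L); rewrite ML0 addn0 aline_dim => dML.
have : (\dim (M + val L) <= 2 * n + m + 1)%N.
  by rewrite -[X in (_ <= X)%N](dim_space F) dimvS ?subvf.
rewrite dML; move: dM; nat_lia.
Qed.

(* The dual word of M: 1 at the affine points of M and -1 at the tangent points
   whose egg element misses M. *)
Lemma affine_sum c M : c \in code p G -> ~~ (M <= H)%VS -> (n + m < \dim M)%N ->
  \sum_(P | (val P <= M)%VS) c (aff P)
    = \sum_(U | (M :&: eg U)%VS == 0%VS) c (tan U).
Proof.
move=> cC MH dM; have [a aE] := code_sum cC.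
under eq_bigr => P _ do rewrite aE.
under [RHS]eq_bigr => U _ do rewrite aE.
rewrite (exchange_big_dep predT) //= [RHS](exchange_big_dep predT) //=.
apply: eq_bigr => l _; rewrite !sumr_const -[LHS]mulr_natr -[RHS]mulr_natr; congr (_ * _).
(* On a line of type (a) both counts are 1 or both are 0 modulo p; on a line of type (b) there is no
   affine point, and the number of tangent points is q ^ n or 0. *)
case: l => [L|[X XE]].
  have := count_affine_line L MH dM; rewrite cardsE.
  rewrite (eq_card (B := [pred P : affine_point H | (val P <= M)%VS && inc (aff P) (inl L)])); last first.
    by move=> P; rewrite !inE andbC.
  move=> ->; have [U LU uniqU] := tan_aline L.
  have -> : #|[pred U | ((M :&: eg U)%VS == 0%VS) && inc (tan U) (inl L)]| = ((M :&: eg U)%VS == 0%VS).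
    case: (boolP (_ == _)) => MU.
      rewrite (eq_card (B := pred1 U)) ?card1 // => U'; rewrite !inE /=.
      apply/andP/eqP => [[_ /uniqU //]|->]; by rewrite MU.
    rewrite eq_card0 // => U'; rewrite !inE /=; apply/negP => /andP [MU' /uniqU U'U].
    by rewrite -U'U MU' in MU.
  by rewrite (tan_aline_eg LU).
rewrite eq_card0; last by move=> P; rewrite unfold_in /= andbF.
have [MX|MX] := boolP ((M :&: X)%VS == 0%VS).
  rewrite (eq_card (B := [set U : tangent_point H E | (X <= val U)%VS])).
    by rewrite card_tan_egg // natr_expq.
  move=> U; rewrite [LHS]unfold_in inE /= sub_eg // andbC.
  by case: eqP => //= ->; rewrite MX.
rewrite eq_card0 // => U; rewrite unfold_in /= sub_eg // andbC.
by case: eqP => //= ->; apply: negbTE.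
Qed.

Lemma wt_T c : wt c = (#|[set P | c (aff P) != 0%R]| + #|[set U | c (tan U) != 0%R]|
                       + (c infp != 0%R))%N.
Proof. by rewrite /wt -sum1dep_card sum_point !sum1dep_card. Qed.

(** * Codewords that vanish at all affine points *)

Lemma sum_aline c L : (forall P, c (aff P) = 0) ->
  \sum_(y | inc y (aline L)) c y = \sum_(U | (val L <= val U)%VS) c (tan U).
Proof. by move=> c_aff; rewrite sum_point /= big1 ?add0r ?addr0. Qed.

(** The constant [b] is the sum of all line coefficients. The first two facts are
    [sum_lines_through] at an affine point and at a point of type (ii), the third is
    [affine_sum]. *)
Lemma affine_free_sums c : c \in code p G -> (forall P, c (aff P) = 0) ->
  exists b : 'F_p, [/\
    forall P : affine_point H, \sum_(U | (val P <= val U)%VS) c (tan U) = b,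
    forall X, X \in E -> \sum_(U | eg U == X) c (tan U) + c infp = b
  & forall M, ~~ (M <= H)%VS -> (n + m < \dim M)%N ->
      \sum_(U | (M :&: eg U)%VS == 0%VS) c (tan U) = 0].
Proof.
move=> cC c_aff; have [a aE] := code_sum cC.
have law (x : point G) := sum_lines_through G_GQ (natr_expq n_gt0) (natr_expq m_gt0) x aE.
exists (\sum_l a l); split=> [P|X XE|M MH dM]; last first.
- by rewrite -affine_sum // big1.
- have [U XU] : exists U : tangent_point H E, (X <= val U)%VS.
    have /card_gt0P [U] : (0 < #|[set U : tangent_point H E | (X <= val U)%VS]|)%N.
      by rewrite card_tan_egg // expn_gt0 ltnW ?card_gt1.
    by rewrite inE; exists U.
  rewrite -(law (tan U)) sum_line /=.
  (* Each of the q ^ m lines of type (a) through [U] has the sum [c (tan U)], and q ^ m is 0 modulo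
     p; only the line of type (b) remains. *)
  have -> : \sum_(L : affine_line H E | (val L <= val U)%VS)
      \sum_(y | inc y (aline L)) c y = 0.
    rewrite (eq_bigr (fun=> c (tan U))) => [|L LU].
      have one : #|[set Y : egg_line E | (val Y <= val U)%VS]| = 1%N.
        apply/eqP/cards1P; exists (Sub X XE); apply/setP => Y; rewrite !inE.
        rewrite sub_eg ?(valP Y) // -(eg_unique XE XU).
        by apply/eqP/eqP => [XY|->] //; apply/val_inj.
      have [_ _ _ /(_ (tan U)) + _] := G_GQ.
      rewrite -sum1dep_card sum_line /= !sum1dep_card one => cE.
      have {}cE : #|[set L : affine_line H E | (val L <= val U)%VS]| = (q ^ m)%N.
        by apply: (@addIn 1); rewrite [RHS]addn1.
      by rewrite sumr_const -mulr_natr -cardsE cE natr_expq ?mulr0.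
    rewrite sum_aline //; have [U0 LU0 uniqU] := tan_aline L.
    rewrite (uniqU U LU) (big_pred1 U0) // => U'.
    by apply/idP/eqP => [/uniqU //|->].
  rewrite add0r (big_pred1 (Sub X XE : egg_line E)) => [|Y].
    rewrite sum_point /= big_pred0_eq add0r; congr (_ + _).
    by apply: eq_bigl => U'; rewrite sub_eg.
  rewrite /= sub_eg ?(valP Y) // -(eg_unique XE XU).
  by apply/eqP/eqP => [XY|->] //; apply/val_inj.
rewrite -(law (aff P)) sum_line [X in _ + X]big_pred0 // addr0.
under [RHS]eq_bigr => L _ do rewrite sum_aline //.
rewrite (exchange_big_dep predT) //= [LHS]big_mkcond; apply: eq_bigr => U _.
rewrite sumr_const; have [PU|PU] := boolP (val P <= val U)%VS; last first.
  rewrite eq_card0 ?mulr0n // => L; rewrite unfold_in; apply/negP => /andP [PL LU].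
  by case/negP: PU; apply: subv_trans LU.
have [L LE LX] := aline_through P (proj1 (egP U)).
rewrite (eq_card (B := pred1 L)) ?card1 // => L'; rewrite [LHS]unfold_in inE.
apply/andP/eqP => [[PL' L'U]|->]; last first.
  by rewrite LE addvSl subv_add PU eg_sub.
apply/val_inj/esym/eqP; rewrite eqEdim !aline_dim leqnn andbT LE subv_add PL' /=.
by rewrite (tan_aline_eg L'U) capvSl.
Qed.

(** The intersection misses [eg U'], which is disjoint from the tangent space at [eg U]; both lie in
    the tangent space at [eg U'], of dimension n + m. *)
Lemma tan_cap_dim (U U' : tangent_point H E) : eg U' != eg U ->
  (\dim (val U :&: val U' :&: H) <= m)%N.
Proof.
move=> ne; have [_ /and4P [_ _ _ /forall_inP tU]] := egP U.
have [eE /and4P [_ _ eU' _]] := egP U'.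
have /eqP Te : ((val U :&: H) :&: eg U' == 0)%VS by have := tU _ eE; rewrite ne.
have W0 : ((val U :&: val U' :&: H) :&: eg U' = 0)%VS.
  by apply/eqP; rewrite -subv0 -Te !capvS ?capvSl.
have WU' : ((val U :&: val U' :&: H) + eg U' <= val U' :&: H)%VS.
  by rewrite subv_add eU' andbT -capvA capvSr.
have := dimvS WU'; rewrite dimv_disjoint_sum // tan_capH_dim (egg_dim eE) => le.
rewrite -(leq_add2r n); exact: leq_trans le (eq_leq (addnC n m)).
Qed.

Lemma expn_sub e : (q ^ e.+1 - q ^ e = q ^ e * q.-1)%N.
Proof. by rewrite expnSr -[X in (_ - X)%N]muln1 -mulnBr subn1. Qed.

Lemma qpred_gt0 : (0 < q.-1)%N.
Proof. by rewrite -ltnS (ltn_predK (card_gt1 F)) card_gt1. Qed.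

(* Each affine point of U is on a second tangent point of the support, and two
   tangent points at different eggs share at most q ^ m affine points. *)
Lemma tan_cover c (b : 'F_p) U :
    (forall P : affine_point H, \sum_(U | (val P <= val U)%VS) c (tan U) = b) ->
    c (tan U) != b ->
  (q ^ n <= #|[set U' | (c (tan U') != 0%R) && (eg U' != eg U)]|)%N.
Proof.
move=> cP cU; set A := [set U' | _].
pose UH := [pred v : V | (v \in val U) && (v \notin H)].
have cover v : v \in UH -> exists2 U', U' \in A & v \in [pred v : V | v \in val U'].
  rewrite !inE => /andP [vU vH].
  have v0 : v != 0 by apply: contraNneq vH => ->; rewrite mem0v.
  have vok : (\dim <[v]> == 1%N) && ~~ (<[v]> <= H)%VS by rewrite dim_vline v0 -memvE.
  pose P : affine_point H := Sub <[v]>%VS vok.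
  have PU : (val P <= val U)%VS := vU.
  have [U' /and3P [U'U PU' cU']] :
      exists U', [&& U' != U, (val P <= val U')%VS & c (tan U') != 0].
    apply/existsP; apply: contraT; rewrite negb_exists => /forallP no.
    case/eqP: cU; rewrite -(cP P) (bigD1 U) //= big1 ?addr0 // => U'.
    move=> /andP [PU' U'U]; apply/eqP; have := no U'.
    by rewrite U'U PU' /= negbK.
  exists U'; rewrite !inE; last by rewrite memvE.
  rewrite cU'; apply: contra U'U => /eqP ee; apply/eqP.
  exact: tan_unique_through PU' PU ee.
have cardY U' : U' \in A -> (#|[predI UH & [pred v : V | v \in val U']]| <= q ^ m * q.-1)%N.
  rewrite !inE => /andP [_ ne].
  rewrite (eq_card (B := [pred v : V | (v \in (val U :&: val U')%VS) && (v \notin H)])); last first.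
    by move=> v; rewrite !inE memv_cap andbAC.
  rewrite card_vspaceD; have := tan_cap_dim ne.
  have [/capv_idPl ->|/dim_capH ->] := boolP ((val U :&: val U')%VS <= H)%VS.
    by rewrite subnn.
  by move=> em; rewrite expn_sub leq_mul2r leq_pexp2l ?orbT // ltnW ?card_gt1.
have := card_cover_bound cover cardY.
rewrite card_vspaceD tan_dim tan_capH_dim expn_sub expnD -mulnA.
by rewrite leq_pmul2r // muln_gt0 expn_gt0 qpred_gt0 ltnW ?card_gt1.
Qed.

(** The constant of the covering condition is 0, so a point [U] of type (ii) in the support brings q
    ^ n others at other egg elements. This exhausts the weight, and the sum over the line of type
    (b) through [U] is just [c (tan U)], not 0. *)
Lemma affine_free_zero c : c \in code p G -> (forall P, c (aff P) = 0) ->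
    (wt c <= (q ^ n).+1)%N ->
    (forall X, X \in E -> \sum_(U | eg U == X) c (tan U) + c infp = 0) -> c = 0.
Proof.
move=> cC c_aff wc cX; have [b [bP bX _]] := affine_free_sums cC c_aff.
have [X0 X0E] : exists X, X \in E by apply/card_gt0P; rewrite card_egg addn1.
have b0 : b = 0 by rewrite -(bX X0) ?cX.
have no_tan U : c (tan U) = 0.
  apply/eqP; apply: contraT => cU.
  have := tan_cover (b := b) (U := U) bP; rewrite b0 cU => /(_ isT).
  set B := [set U' | _] => cardB.
  have : (#|U |: B| <= #|[set U | c (tan U) != 0%R]|)%N.
    by apply/subset_leq_card/subsetP => U'; rewrite !inE => /orP [/eqP ->|/andP []].
  have UB : U \notin B by rewrite !inE eqxx andbF.
  rewrite cardsU1 UB add1n => leB.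
  move: wc; rewrite wt_T => wc.
  have c_inf : c infp = 0.
    apply/eqP; apply: contraT => c_inf; move: wc leB cardB; rewrite c_inf; nat_lia.
  have supp : U |: B = [set U | c (tan U) != 0%R].
    apply/eqP; rewrite eqEcard; apply/andP; split.
      by apply/subsetP => U'; rewrite !inE => /orP [/eqP ->|/andP []].
    rewrite cardsU1 UB add1n; apply: (@leq_trans (q ^ n).+1); last by rewrite ltnS.
    apply: leq_trans wc; rewrite c_inf eqxx addn0; exact: leq_addl.
  have := cX _ (proj1 (egP U)); rewrite c_inf addr0 (bigD1 U) //= big1 ?addr0.
    by move/eqP; rewrite (negPf cU).
  move=> U' /andP [/eqP ee U'U]; apply/eqP; apply: contraT => cU'.
  by have : U' \in U |: B; [rewrite supp inE | rewrite !inE ee eqxx andbF (negPf U'U)].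
apply/ffunP => -[[P|U]|[]]; rewrite ffunE; [exact: c_aff | exact: no_tan|].
by have := cX _ X0E; rewrite big1 ?add0r.
Qed.

Lemma affine_free_small_word c : c \in code p G -> (forall P, c (aff P) = 0) ->
    (wt c <= (q ^ n).+1)%N -> c != 0 ->
  exists (X : egg_line E) (b : 'F_p), c = b *: incidence_row p (eline X).
Proof.
move=> cC c_aff wc c0; have [b [bP bX bM]] := affine_free_sums cC c_aff.
have b0 : b != 0.
  apply: contraNneq c0 => b0; apply/eqP/affine_free_zero => // X XE.
  by rewrite bX.
have qn1 : (0 < q ^ n)%N by rewrite expn_gt0 ltnW ?card_gt1.
(* If all points of type (ii) on some line of type (b) have the value [b], subtracting [b] times
   that line leaves a word that [affine_free_zero] kills. *)
have [[X0 /forallP allX]|noX] := altP (@existsP _ (fun X : egg_line E =>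
  [forall U : tangent_point H E, (val X <= val U)%VS ==> (c (tan U) == b)])).
  have X0E := valP X0.
  exists X0, b; pose c' : word := c - b *: incidence_row p (eline X0).
  suff c'0 : c' = 0 by apply/eqP; rewrite -subr_eq0; apply/eqP.
  have c'aff P : c' (aff P) = 0 by rewrite !ffunE c_aff [_ *: _]mulr0 subr0.
  have c'tan U : c' (tan U) = if eg U == val X0 then 0 else c (tan U).
    rewrite !ffunE /= sub_eg //; case: eqP => [eU|_]; last by rewrite [_ *: _]mulr0 subr0.
    have := allX U; rewrite sub_eg // eU eqxx => /eqP ->.
    by rewrite [_ *: _]mulr1 subrr.
  have c'inf : c' infp = c infp - b by rewrite !ffunE /= [_ *: _]mulr1.
  have c'C : c' \in code p G by rewrite memvB ?memvZ ?incidence_row_code.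
  have [b' [_ b'X _]] := affine_free_sums c'C c'aff.
  have b'0 : b' = 0.
    rewrite -(b'X _ X0E) c'inf big1 ?add0r => [|U /eqP eU]; last by rewrite c'tan eU eqxx.
    rewrite -(bX _ X0E) opprD addrCA subrr addr0 (eq_bigr (fun=> b)); last first.
      by move=> U /eqP eU; have := allX U; rewrite sub_eg // eU eqxx => /eqP.
    rewrite sumr_const (eq_card (B := [set U : tangent_point H E | (val X0 <= val U)%VS])).
      by rewrite card_tan_egg // -mulr_natr natr_expq // mulr0 oppr0.
    by move=> U; rewrite !inE sub_eg.
  apply: affine_free_zero => // [|X XE]; last by rewrite b'X.
  have disj : [set U : tangent_point H E | (val X0 <= val U)%VS]
      :&: [set U | c' (tan U) != 0] = set0.
    apply/setP => U; rewrite !inE c'tan sub_eg //.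
    by case: (eg U =P val X0); rewrite ?eqxx.
  have split_supp : #|[set U | c (tan U) != 0]| = (q ^ n + #|[set U | c' (tan U) != 0%R]|)%N.
    rewrite -(card_tan_egg X0E) -cardsUI disj cards0 addn0.
    apply: eq_card => U; rewrite !inE c'tan sub_eg //.
    case: (eg U =P val X0) => [eU|] //=.
    by have := allX U; rewrite sub_eg // eU eqxx => /eqP ->; rewrite b0.
  move: wc; rewrite !wt_T split_supp.
  rewrite (_ : [set P | c' (aff P) != 0] = set0) ?cards0; last first.
    by apply/setP => P; rewrite !inE c'aff eqxx.
  move: qn1 (leq_b1 (c' infp != 0)); nat_lia.
(* Otherwise each line of type (b) has a point of type (ii) with a value other than [b], and
   [tan_cover] gives q ^ n support points off that line. *)
have far X : X \in E ->
    (q ^ n <= #|[set U | (c (tan U) != 0%R) && (eg U != X)]|)%N.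
  move=> XE; have : ~~ [forall U : tangent_point H E, (X <= val U)%VS ==> (c (tan U) == b)].
    by apply: contra noX => allX; apply/existsP; exists (Sub X XE).
  rewrite negb_forall => /existsP [U]; rewrite negb_imply sub_eg // => /andP [/eqP <-].
  exact: tan_cover.
have splitX X : #|[set U | c (tan U) != 0%R]| =
    (#|[set U | (c (tan U) != 0%R) && (eg U == X)]|
     + #|[set U | (c (tan U) != 0%R) && (eg U != X)]|)%N.
  rewrite -(cardsID [set U | eg U == X]); congr (_ + _)%N; apply: eq_card => U.
    by rewrite !inE.
  by rewrite !inE andbC.
move: wc; rewrite wt_T => wc.
have le1 X : X \in E ->
    (#|[set U | (c (tan U) != 0%R) && (eg U == X)]| + (c infp != 0%R) <= 1)%N.
  move=> XE; move: wc (far X XE) (splitX X); nat_lia.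
have c_inf : c infp = 0.
  apply/eqP; apply: contraT => c_inf.
  have [X0 X0E] : exists X, X \in E by apply/card_gt0P; rewrite card_egg addn1.
  have /card_gt0P [U] := leq_trans qn1 (far X0 X0E); rewrite inE => /andP [cU _].
  have pos : (0 < #|[set U' | (c (tan U') != 0%R) && (eg U' == eg U)]|)%N.
    by apply/card_gt0P; exists U; rewrite inE cU eqxx.
  by move: pos (le1 _ (proj1 (egP U))); rewrite c_inf; nat_lia.
have one X : X \in E -> #|[set U | (c (tan U) != 0%R) && (eg U == X)]| = 1%N.
  move=> XE; apply/eqP; rewrite eqn_leq; apply/andP; split.
    by have := le1 X XE; rewrite c_inf eqxx addn0.
  rewrite card_gt0; apply: contra_neq b0 => none; rewrite -(bX X XE) c_inf addr0.
  apply: big1 => U /eqP eU; apply/eqP; apply: contraT => cU.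
  by have /setP/(_ U) := none; rewrite !inE cU eU eqxx.
have cardS : #|[set U | c (tan U) != 0%R]| = (q ^ m + 1)%N.
  rewrite -sum1dep_card (partition_big eg (mem E)) /=; last by move=> U _; case: (egP U).
  by rewrite -card_egg -sum1_card; apply: eq_bigr => X XE; rewrite sum1dep_card one.
have [X0 X0E] : exists X, X \in E by apply/card_gt0P; rewrite card_egg addn1.
(* The support has q ^ m + 1 points, which the weight bounds by q ^ n + 1; the q ^ m of them off
   [X0] number at least q ^ n. *)
have nm : n = m.
  apply/eqP; rewrite -(eqn_exp2l n m (card_gt1 F)); apply/eqP.
  have := splitX X0; have := far X0 X0E; rewrite one // cardS; move: wc; rewrite cardS c_inf eqxx; nat_lia.
have [X1 /setD1P [X10 X1E]] : exists X, X \in E :\ X0.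
  have := cardsD1 X0 E; rewrite X0E card_egg [LHS]addn1 => -[qE].
  have qm0 : (0 < q ^ m)%N by rewrite expn_gt0 ltnW ?card_gt1.
  apply/set0Pn; rewrite -card_gt0; exact: leq_trans qm0 (eq_leq qE).
have [_ _ E3 _] := E_egg.
have [v _ vH] : exists2 v, v \in {:V}%VS & v \notin H.
  by apply/subvPn/negP => /dimvS; rewrite H_dim dim_space; nat_lia.
have v0 : v != 0 by apply: contraNneq vH => ->; rewrite mem0v.
pose K := (X0 + X1)%VS; pose M := (<[v]> + K)%VS.
have KH : (K <= H)%VS by rewrite subv_add !egg_sub.
have tri X : X \in E -> X != X0 -> X != X1 -> (K :&: X = 0)%VS.
  move=> XE XX0 XX1; apply/eqP; rewrite -dimv_eq0.
  have d3 := E3 X0 X1 X X0E X1E XE; rewrite eq_sym X10 eq_sym XX0 eq_sym XX1 in d3.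
  have := dimv_sum_cap K X; rewrite d3 // (egg_dim XE).
  have := dimv_sum_cap X0 X1; rewrite (egg_dim X0E) (egg_dim X1E) -/K; nat_lia.
have X01 : (X0 :&: X1 = 0)%VS.
  have [_ _ _ /(_ X0 X0E) [T /and4P [_ _ X0T /forall_inP tT]]] := E_egg.
  have := tT X1 X1E; rewrite X10 => /eqP TX1.
  by apply/eqP; rewrite -subv0 -TX1 capvS.
have dK : \dim K = (n + n)%N by rewrite dimv_disjoint_sum ?egg_dim.
have MH : ~~ (M <= H)%VS.
  by apply: contra vH => MH; rewrite memvE; apply: subv_trans MH; apply: addvSl.
have dM : \dim M = (n + n).+1.
  rewrite dimv_disjoint_sum ?dim_vline ?v0 ?dK // dim1_capE ?dim_vline ?v0 //.
  by apply: contra vH => vK; rewrite memvE (subv_trans vK).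
have MK : (M :&: H)%VS = K.
  by apply/esym/eqP; rewrite eqEdim subv_cap addvSr KH dK -ltnS -dim_capH ?dM ?ltnSn.
have capK X : X \in E -> (M :&: X = K :&: X)%VS.
  by move=> XE; rewrite -[in LHS](capv_idPr (egg_sub XE)) capvA MK.
have ltM : (n + m < \dim M)%N by rewrite dM -nm ltnSn.
(* Exactly q ^ m - 1 egg elements miss [M], each carrying the sum [b]; modulo p the total is - b,
   not 0. *)
have := bM M MH ltM.
rewrite (partition_big eg [pred X | X \in E :\ X0 :\ X1]) /= => [|U]; last first.
  have UE := proj1 (egP U); rewrite (capK _ UE) => KU.
  have nz X : X \in E -> (X <= K)%VS -> eg U != X.
    move=> XE XK; apply: contraTneq KU => ->; rewrite (capv_idPr XK) -dimv_eq0.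
    by rewrite egg_dim // -lt0n.
  apply/setD1P; split; first exact: (nz X1 X1E (addvSr _ _)).
  by apply/setD1P; split; first exact: (nz X0 X0E (addvSl _ _)).
rewrite (eq_bigr (fun=> b)) => [|X /setD1P [XX1 /setD1P [XX0 XE]]].
  rewrite sumr_const -mulr_natr => /eqP; rewrite mulf_eq0 (negPf b0) /= => /eqP N0.
  have {}N0 : #|E :\ X0 :\ X1|%:R = 0 :> 'F_p := N0.
  have := cardsD1 X0 E; rewrite X0E card_egg [LHS]addn1 => -[qE].
  have X1E0 : X1 \in E :\ X0 by apply/setD1P.
  have := cardsD1 X1 (E :\ X0); rewrite X1E0 => NE.
  have cN : (q ^ m)%N = (1 + #|E :\ X0 :\ X1|)%N := etrans qE NE.
  have := natr_expq m_gt0; rewrite cN natrD N0 addr0 => /eqP.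
  by rewrite oner_eq0.
have := bX X XE; rewrite c_inf addr0 => <-; apply: eq_bigl => U.
apply/andP/idP => [[]//|/eqP eU]; split; last by rewrite eU.
by rewrite eU (capK X XE) tri.
Qed.

(* The cosets of K = M :&: H all carry the same sum, so if it is not zero they
   all meet the support. *)
Lemma coset_cover c K (B : {set {vspace V}}) : c \in code p G ->
    (K <= H)%VS -> \dim K = (n + m)%N ->
    \sum_(U | (K :&: eg U)%VS == 0%VS) c (tan U) != 0 ->
    (forall P, c (aff P) != 0 -> exists2 x, x \in B & (val P <= x + K)%VS) ->
    (forall x, x \in B -> \dim x = 1%N /\ ~~ (x <= H)%VS) ->
  (q ^ n <= #|B|)%N.
Proof.
move=> cC KH dK cK0 cB B1.
have sum1 x : \dim x = 1%N -> ~~ (x <= H)%VS ->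
    [/\ ~~ ((x + K)%VS <= H)%VS, \dim (x + K) = (n + m).+1 & ((x + K) :&: H)%VS = K].
  move=> x1 xH; have MH : ~~ ((x + K)%VS <= H)%VS.
    by apply: contra xH; apply: subv_trans (addvSl _ _).
  have dM : \dim (x + K) = (n + m).+1.
    rewrite dimv_disjoint_sum ?x1 ?dK // dim1_capE //.
    by apply: contra xH => xK; apply: subv_trans KH.
  split=> //; apply/esym/eqP.
  by rewrite eqEdim subv_cap addvSr KH dK -ltnS -dim_capH ?dM ?ltnSn.
pose VH := [pred v : V | (v \in {:V}%VS) && (v \notin H)].
have cover v : v \in VH -> exists2 x, x \in B & v \in [pred v : V | v \in (x + K)%VS].
  rewrite !inE => /andP [_ vH].
  have v0 : v != 0 by apply: contraNneq vH => ->; rewrite mem0v.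
  have v1 : \dim <[v]> = 1%N by rewrite dim_vline v0.
  have [|MH dM MK] := sum1 _ v1; first by rewrite -memvE.
  have := affine_sum cC MH; rewrite dM => /(_ (leqnn _)).
  rewrite (eq_bigl (fun U => (K :&: eg U)%VS == 0%VS)) => [sE|U]; last first.
    by rewrite -[in LHS](capv_idPr (egg_sub (proj1 (egP U)))) capvA MK.
  have [P /andP [PM cP]] : exists P : affine_point H,
      (val P <= <[v]> + K)%VS && (c (aff P) != 0).
    apply/existsP; apply: contraT; rewrite negb_exists => /forallP no.
    case/eqP: cK0; rewrite -sE big1 // => P PM; apply/eqP.
    by have := no P; rewrite PM /= negbK.
  have [x xB Px] := cB P cP; exists x => //; rewrite inE.
  have [x1 xH] := B1 x xB; have [_ dx _] := sum1 x x1 xH.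
  have [_ dP _] := sum1 _ (aff_dim P) (aff_notin P).
  have eqP1 : (val P + K)%VS = (<[v]> + K)%VS.
    by apply/eqP; rewrite eqEdim subv_add PM addvSr dP dM leqnn.
  have eqP2 : (val P + K)%VS = (x + K)%VS.
    by apply/eqP; rewrite eqEdim subv_add Px addvSr dP dx leqnn.
  by rewrite -eqP2 eqP1 memvE addvSl.
have cardY x : x \in B ->
    (#|[predI VH & [pred v : V | v \in (x + K)%VS]]| <= q ^ (n + m) * q.-1)%N.
  move=> /B1 [x1 xH]; have [_ dx xK] := sum1 x x1 xH.
  rewrite -expn_sub -dx -[X in (_ - q ^ X)%N]dK -[X in (_ - q ^ \dim X)%N]xK -card_vspaceD.
  by apply/subset_leq_card/subsetP => v; rewrite !inE => /andP [/andP [_ ->] ->].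
have := card_cover_bound cover cardY.
have qE : (q ^ (2 * n + m + 1) - q ^ (2 * n + m) = q ^ n * (q ^ (n + m) * q.-1))%N.
  by rewrite addn1 expn_sub mul2n -addnn -addnA expnD -mulnA.
rewrite card_vspaceD capfv dim_space H_dim qE leq_pmul2r //.
by rewrite muln_gt0 expn_gt0 qpred_gt0 ltnW ?card_gt1.
Qed.

Lemma min_words_T_egg : min_words_are_lines p G (q ^ n).
Proof.
move=> c cC c0 wc.
have [[P0 cP0]|no_aff] := altP (@existsP _ (fun P => c (aff P) != 0)); last first.
  have [|X [b cE]] := affine_free_small_word cC _ wc c0; last by exists (eline X), b.
  by move=> P; apply/eqP; move: no_aff; rewrite negb_exists => /forallP /(_ P); rewrite negbK.
pose S := [set val P | P in [set P | c (aff P) != 0]].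
have cardS : #|S| = #|[set P | c (aff P) != 0]| by apply/card_imset/val_inj.
have SP P : (val P \in S) = (c (aff P) != 0).
  by rewrite mem_imset ?inE //; apply: val_inj.
have S1 x : x \in S -> \dim x = 1%N /\ ~~ (x <= H)%VS.
  by case/imsetP => P _ ->; rewrite aff_dim aff_notin.
have line_eq := @dim1_eq F (2 * n + m + 1).
move: (wc); rewrite wt_T -cardS => wcS.
have P0S : val P0 \in S by rewrite SP.
(* Among the affine points of the support, [M] contains only [P0], so its sum is not 0 and the dual
   word of [M] yields a support point [U0] of type (ii). *)
have [||M [PM avoidM dM]] := @avoid_points _ _ n (val P0) (S :\ val P0) n_gt0.
- have leS : (#|S| <= (q ^ n).+1)%N.
    exact: leq_trans (leq_trans (leq_addr _ _) (leq_addr _ _)) wcS.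
  have := cardsD1 (val P0) S; rewrite P0S add1n => cS.
  exact: (leq_trans (eq_leq (esym cS)) leS).
- move=> x; rewrite !inE => /andP [xP xS]; have [x1 xH] := S1 x xS.
  split=> //; apply: contra xP => xP; apply/eqP/line_eq => //; exact: aff_dim.
have MH : ~~ (M <= H)%VS by apply: contra (aff_notin P0); apply: subv_trans.
have dM' : (n + m < \dim M)%N by move: dM; nat_lia.
have sumM := affine_sum cC MH dM'.
have sumP0 : \sum_(P : affine_point H | (val P <= M)%VS) c (aff P) = c (aff P0).
  rewrite (bigD1 P0) //= big1 ?addr0 // => P /andP [PM' PP0]; apply/eqP.
  apply: contraTT PM' => cP; apply: avoidM; rewrite !inE SP cP andbT.
  by apply: contra PP0 => /eqP/val_inj ->.
have [U0 /andP [MU0 cU0]] : exists U, ((M :&: eg U)%VS == 0%VS) && (c (tan U) != 0).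
  apply/existsP; apply: contraT; rewrite negb_exists => /forallP no.
  case/eqP: cP0; rewrite -sumP0 sumM big1 // => U MU; apply/eqP.
  by have := no U; rewrite MU /= negbK.
have [U0E _] := egP U0; set X0 := eg U0 in MU0 U0E.
have tan_gt0 : (0 < #|[set U | c (tan U) != 0%R]|)%N.
  by apply/card_gt0P; exists U0; rewrite inE.
have dMH : \dim M = (\dim (M :&: H)).+1 := dim_capH MH.
have capM U : ((M :&: H) :&: eg U)%VS = (M :&: eg U)%VS.
  by rewrite -capvA (capv_idPr (egg_sub (proj1 (egP U)))).
have dK : \dim (M :&: H) = (n + m)%N.
  have := dimv_sum_cap (M :&: H) X0; rewrite capM (eqP MU0) dimv0 (egg_dim U0E).
  have : (\dim (M :&: H + X0) <= \dim H)%N by rewrite dimvS // subv_add capvSr egg_sub.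
  rewrite H_dim; move: dMH dM'; nat_lia.
have Sq : #|S| = (q ^ n)%N.
  apply/eqP; rewrite eqn_leq; apply/andP; split; first by move: wcS tan_gt0; nat_lia.
  apply: (coset_cover cC _ dK); rewrite ?capvSr //.
    by rewrite (eq_bigl (fun U => (M :&: eg U)%VS == 0%VS)) -?sumM ?sumP0 // => U; rewrite capM.
  by move=> P cP; exists (val P); rewrite ?addvSl ?SP.
have leT : (#|[set U | c (tan U) != 0%R]| <= 1)%N by move: wcS; rewrite Sq; nat_lia.
have tan1 : [set U | c (tan U) != 0%R] = [set U0].
  apply/esym/eqP; rewrite eqEcard sub1set inE cU0 cards1 /=; exact: leT.
have c_inf : c infp = 0.
  apply/eqP; apply: contraT => c_inf; move: wcS; rewrite Sq tan1 cards1 c_inf; nat_lia.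
have cU U : U != U0 -> c (tan U) = 0.
  move=> UU0; apply/eqP; apply: contraNT UU0 => cU.
  by have /setP/(_ U) := tan1; rewrite !inE cU => /esym.
set b := c (tan U0) in cU0.
have sumK K : \sum_(U | (K :&: eg U)%VS == 0%VS) c (tan U) = b * ((K :&: X0)%VS == 0%VS)%:R.
  have [KX|KX] := boolP ((K :&: X0)%VS == 0%VS).
    by rewrite (bigD1 U0) //= big1 ?addr0 ?mulr1 // => U /andP [_ /cU].
  by rewrite mulr0 big1 // => U KU; apply: cU; apply: contraNneq KX => UE; rewrite UE in KU.
have [L LE LX] := aline_through P0 U0E.
have SL x : x \in S -> (x <= val L)%VS.
  move=> xS; have [x1 xH] := S1 x xS; have d0 := aff_dim P0; rewrite LE.
  have [->|xP] := eqVneq x (val P0); first exact: addvSl.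
  pose d := ((val P0 + x) :&: H)%VS.
  have d2 : \dim (val P0 + x) = 2.
    rewrite dimv_disjoint_sum ?d0 ?x1 // dim1_capE //.
    by apply: contra xP => Px; rewrite (line_eq _ _ d0 x1 Px).
  have dH : ~~ ((val P0 + x)%VS <= H)%VS.
    by apply: contra xH; apply: subv_trans (addvSr _ _).
  have d1 : \dim d = 1%N by have := dim_capH dH; rewrite d2 => -[].
  have Pd : (val P0 + d)%VS = (val P0 + x)%VS.
    apply/eqP; rewrite eqEdim subv_add addvSl capvSl d2 dimv_disjoint_sum ?d0 ?d1 //.
    by rewrite dim1_capE //; apply: contra (aff_notin P0) => /subv_trans; apply; apply: capvSr.
  have [dX|dX] := boolP (d <= X0)%VS.
    by apply: subv_trans (addvSr (val P0) x) _; rewrite -Pd addvS.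
  (* If the direction [d] of the line joining [P0] and [x] is outside [X0], this [K] is a complement
     of [X0] in [H] containing [d]. Then [P0] and [x] lie in one coset of [K], so [S] without [x]
     would still meet all q ^ n cosets. *)
  pose K := (d + (H :\: (X0 + d)))%VS.
  have KH : (K <= H)%VS by rewrite subv_add capvSr diffvSl.
  have dX0 : (X0 + d <= H)%VS by rewrite subv_add egg_sub // capvSr.
  have KXH : (K + X0)%VS = H.
    apply/eqP; rewrite eqEsubv subv_add KH egg_sub //=.
    rewrite -{1}(addv_diff_cap H (X0 + d)) subv_add (capv_idPr dX0).
    have d_sub : (d <= K + X0)%VS := subv_trans (addvSl _ _) (addvSl _ _).
    have WK : (H :\: (X0 + d) <= K + X0)%VS := subv_trans (addvSr _ _) (addvSl _ _).
    by rewrite WK subv_add addvSr d_sub.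
  have dXd : \dim (X0 + d) = n.+1.
    by rewrite addvC dimv_disjoint_sum ?d1 ?(egg_dim U0E) // dim1_capE.
  have dKn : \dim K = (n + m)%N /\ (K :&: X0)%VS = 0%VS.
    have dW : (n.+1 + \dim (H :\: (X0 + d)) = 2 * n + m)%N.
      by have := dimv_cap_compl H (X0 + d); rewrite (capv_idPr dX0) dXd H_dim.
    have leK : (\dim K <= 1 + \dim (H :\: (X0 + d)))%N.
      by rewrite -[X in (_ <= X + _)%N]d1; apply: (dimv_add_leqif _ _).1.
    have dKX : (2 * n + m + \dim (K :&: X0) = \dim K + n)%N.
      by have := dimv_sum_cap K X0; rewrite KXH H_dim (egg_dim U0E).
    have KX0 : \dim (K :&: X0) = 0%N by move: dW leK dKX; nat_lia.
    have dKE : \dim K = (n + m)%N by move: dW leK dKX; nat_lia.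
    by split=> //; apply/eqP; rewrite -dimv_eq0 KX0.
  have [dK' KX0] := dKn.
  have := @coset_cover c K (S :\ x) cC KH dK'; rewrite sumK KX0 eqxx mulr1 => /(_ cU0).
  have := cardsD1 x S; rewrite xS Sq => SE; rewrite SE => bad.
  suff : (true + #|S :\ x| <= #|S :\ x|)%N by rewrite add1n ltnn.
  apply: bad => [P|y /setD1P [_ /S1 //]].
  rewrite -SP => PS; have [PEx|Px] := eqVneq (val P) x; last first.
    by exists (val P); rewrite ?addvSl // !inE Px.
  exists (val P0); first by rewrite !inE eq_sym xP.
  rewrite PEx; apply: subv_trans (addvSr (val P0) x) _; rewrite -Pd.
  by rewrite addvS ?addvSl.
have SE P : (c (aff P) != 0) = (val P <= val L)%VS.
  have : [set P | c (aff P) != 0] = [set P : affine_point H | (val P <= val L)%VS].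
    apply/eqP; rewrite eqEcard -cardS Sq card_aff ?aline_notin // LX egg_dim // leqnn andbT.
    by apply/subsetP => P'; rewrite !inE -SP => /SL.
  by move/setP/(_ P); rewrite !inE.
(* The coset through [P] of a complement of [X0] in [H] meets [L] in [P] alone. *)
have cb P : (val P <= val L)%VS -> c (aff P) = b.
  move=> PL; pose K := (H :\: X0)%VS; pose M' := (val P + K)%VS.
  have KX0 : (K :&: X0)%VS = 0%VS by apply: capv_diff.
  have KH : (K <= H)%VS by apply: diffvSl.
  have dK' : \dim K = (n + m)%N.
    have := dimv_cap_compl H X0; rewrite (capv_idPr (egg_sub U0E)) (egg_dim U0E) H_dim -/K; nat_lia.
  have M'H : ~~ (M' <= H)%VS.
    by apply: contra (aff_notin P); apply: subv_trans (addvSl _ _).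
  have dM1 : \dim M' = (n + m).+1.
    rewrite dimv_disjoint_sum ?aff_dim ?dK' // dim1_capE ?aff_dim //.
    by apply: contra (aff_notin P) => PK; apply: subv_trans KH.
  have M'K : (M' :&: H)%VS = K.
    by apply/esym/eqP; rewrite eqEdim subv_cap addvSr KH dK' -ltnS -dim_capH ?dM1 ?ltnSn.
  have := affine_sum cC M'H; rewrite dM1 => /(_ (leqnn _)).
  rewrite (eq_bigl (fun U => (K :&: eg U)%VS == 0%VS)) => [|U]; last first.
    by rewrite -[in LHS](capv_idPr (egg_sub (proj1 (egP U)))) capvA M'K.
  rewrite sumK KX0 eqxx mulr1 => <-; rewrite (bigD1 P) ?addvSl //= big1 ?addr0 //.
  move=> P' /andP [P'M P'P]; apply/eqP; apply: contraNT P'P; rewrite SE => P'L.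
  have LMH : ~~ ((M' :&: val L)%VS <= H)%VS.
    apply: contra (aff_notin P); apply: subv_trans.
    by rewrite subv_cap PL addvSl.
  have := dim_capH LMH; rewrite -capvA LX -(capv_idPr (egg_sub U0E)) capvA M'K KX0 dimv0 => dLM.
  apply/eqP/val_inj; rewrite (line_eq (val P') (M' :&: val L)%VS) ?aff_dim ?subv_cap ?P'M //.
  by apply/esym/line_eq; rewrite ?aff_dim ?subv_cap ?PL ?addvSl.
(* The remainder is supported on at most [U0] and [U1], so if nonzero it is a multiple of a line of
   type (b); but it vanishes at (infty). *)
exists (aline L), b; pose c' : word := c - b *: incidence_row p (aline L).
suff c'0 : c' = 0 by apply/eqP; rewrite -subr_eq0; apply/eqP.
apply/eqP; apply: contraT => c'0.
have c'aff P : c' (aff P) = 0.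
  rewrite !ffunE /=; case: (boolP (val P <= val L)%VS) => PL.
    by rewrite cb // [_ *: _]mulr1 subrr.
  by rewrite [_ *: _]mulr0 subr0; apply/eqP; move: PL; rewrite -SE negbK.
have c'inf : c' infp = 0 by rewrite !ffunE c_inf [_ *: _]mulr0 subr0.
have c'C : c' \in code p G by rewrite memvB ?memvZ ?incidence_row_code.
have [U1 LU1 uniqU] := tan_aline L.
have wc' : (wt c' <= (q ^ n).+1)%N.
  rewrite wt_T c'inf eqxx addn0 (_ : [set P | c' (aff P) != 0] = set0) ?cards0; last first.
    by apply/setP => P; rewrite !inE c'aff eqxx.
  apply: (@leq_trans #|[set U0; U1]|); last first.
    have : (0 < q ^ n)%N by rewrite expn_gt0 ltnW ?card_gt1.
    by rewrite cards2; case: (_ != _); nat_lia.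
  apply/subset_leq_card/subsetP => U; rewrite !inE; apply: contraR.
  rewrite negb_or => /andP [/cU c0' UU1]; rewrite !ffunE c0' sub0r /=.
  have [/uniqU UE|] := boolP (val L <= val U)%VS; first by rewrite UE eqxx in UU1.
  by rewrite [_ *: _]mulr0 oppr0.
have [X [b' c'E]] := affine_free_small_word c'C c'aff wc' c'0.
by move: c'inf c'0; rewrite c'E !ffunE [_ *: _]mulr1 => ->; rewrite scale0r eqxx.
Qed.

End Eggs.

Lemma translation_repair p h q n m s t (G : incidence_structure) :
    prime p -> (0 < h)%N -> q = (p ^ h)%N -> (0 < n)%N -> (0 < m)%N ->
    s = (q ^ n)%N -> t = (q ^ m)%N -> generalised_quadrangle s t G ->
    translation_GQ q n m G ->
  repair_degree (dual (code p G)) = s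
  /\ repair_availability (dual (code p G)) = ((p - 1) * (t + 1))%N.
Proof.
move=> p_pr h0 qE n0 m0 sE tE G_GQ [F [H [E [Fq Hd Eegg iso]]]].
have qp : #|F|%:R = 0 :> 'F_p.
  by rewrite Fq qE natrX (pcharf0 (pchar_Fp p_pr)) expr0n -[_ == _]negbK -lt0n h0.
have := gq_isomorphic iso G_GQ; rewrite sE tE -Fq => T_GQ.
rewrite sE tE -Fq in G_GQ *.
apply: (repair_of_isomorphic (s' := (#|F| ^ n)%N) p_pr G_GQ iso).
- by apply/card_gt0P; exists (inr tt).
- by rewrite expn_gt0 ltnW ?card_gt1.
- by case: T_GQ.
exact: min_words_T_egg.
Qed.

Local Close Scope ring_scope.
Unset Implicit Arguments.

(* T_2^*(O) over the field with two elements is excluded: it is the complete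
   bipartite graph K_{4,4}, whose binary code contains every word of weight 2,
   so the availability is 7 and not (p - 1)(t + 1) = 4. *)
Theorem theorem5p4 (p h q s t : nat) (G : incidence_structure)
    (p_prime : prime p) (h_gt0 : 0 < h) (q_def : q = p ^ h)
    (G_GQ : generalised_quadrangle s t G)
    (G_family :
      [\/ classical_GQ q G,
          [/\ ~~ odd q, 2 < q & T2star_GQ q G]
        | exists n m : nat,
            [/\ 0 < n, 0 < m, s = q ^ n, t = q ^ m & translation_GQ q n m G]]) :
  let C := dual (code p G) in
  repair_degree C = s /\ repair_availability C = (p - 1) * (t + 1).
Proof.
case: G_family => [G_cl|[q_even q_gt2 G_T2]|[n [m [n_gt0 m_gt0 s_def t_def G_T]]]].
- exact: classical_repair p_prime h_gt0 q_def G_GQ G_cl.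
- exact: T2star_repair p_prime q_def q_even q_gt2 G_GQ G_T2.
exact: translation_repair p_prime h_gt0 q_def n_gt0 m_gt0 s_def t_def G_GQ G_T.
Qed.
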